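(* Let $\mathbb{K}=\mathbb{R}$ or $\mathbb{C}$, and let $k_1,\ldots,k_n$ be nonnegative integers whose sum is $m$. Then for every $L^p(\mu)$ space over $\mathbb{K}$, $1\le p\le\infty$, $$\mathbb{K}(k_1,\ldots,k_n;L^p(\mu))\le n^{m\left|\frac12-\frac1p\right|}.$$ If $X$ is any Banach space over $\mathbb{K}$, then $$\mathbb{K}(k_1,\ldots,k_n;X)\le n^{\frac m2}.$$ In particular, if $k_1=\cdots=k_n=1$, then $n=m$ and $$\mathbb{K}(m,L^p(\mu))\le m^{m\left|\frac12-\frac1p\right|}\qquad\text{and}\qquad \mathbb{K}(m,X)\le m^{\frac m2}.$$
   Context: Let $X$ be a Banach space over $\mathbb{K}$ ($\mathbb{K}=\mathbb{R}$ or $\mathbb{C}$) with closed unit ball $B_X$. $\mathcal{L}^s({}^mX;\mathbb{K})$ denotes the space of continuous symmetric $m$-linear forms $L:X^m\to\mathbb{K}$. For such $L$, $\widehat{L}(x)=L(x,\ldots,x)$ is the associated $m$-homogeneous polynomial, with $\|\widehat{L}\|=\sup_{x\in B_X}|\widehat{L}(x)|$, and $\|L\|=\sup_{x_1,\ldots,x_m\in B_X}|L(x_1,\ldots,x_m)|$. For nonnegative integers $k_1,\ldots,k_n$ with sum $m\ge 1$, $L(x_1^{k_1}\ldots x_n^{k_n})$ denotes the value of $L$ with $x_i$ placed in $k_i$ of the coordinates, $i=1,\ldots,n$. Define $$\mathbb{K}(k_1,\ldots,k_n;X)=\inf\Big\{M>0:\ \sup_{x_1,\ldots,x_n\in B_X}|L(x_1^{k_1}\ldots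 x_n^{k_n})|\le M\|\widehat{L}\|\ \ \forall L\in\mathcal{L}^s({}^mX;\mathbb{K})\Big\},$$ and $\mathbb{K}(m,X)=\inf\{M>0:\ \|L\|\le M\|\widehat{L}\|\ \ \forall L\in\mathcal{L}^s({}^mX;\mathbb{K})\}$, which is the special case $n=m$, $k_1=\cdots=k_m=1$. Convention: $1/\infty=0$. $\mu$ is an arbitrary measure. *)

(* Defs.v *)
From HB Require Import structures.
From mathcomp Require Import all_boot all_order all_algebra.
From mathcomp Require Import fingroup perm generic_quotient.
From mathcomp Require Import all_classical all_reals all_analysis.
From mathcomp Require Import measurable_realfun ess_sup_inf complex.

Set Implicit Arguments.
Unset Strict Implicit.
Unset Printing Implicit Defensive.

Import Order.TTheory GRing.Theory Num.Theory.
Import numFieldNormedType.Exports.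

Local Open Scope classical_set_scope.
Local Open Scope ring_scope.

Variant scalar_kind := RealScalars | ComplexScalars.

Definition scalar_field (R : realType) (s : scalar_kind) : numFieldType :=
  match s with RealScalars => R | ComplexScalars => R[i] end.

Section Scalars.
Context {R : realType} {s : scalar_kind}.
Local Notation K := (scalar_field R s).

Definition sc_re : K -> R :=
  match s return scalar_field R s -> R with
  | RealScalars => id
  | ComplexScalars => fun z => complex.Re z
  end.

Definition sc_im : K -> R :=
  match s return scalar_field R s -> R with
  | RealScalars => fun=> 0
  | ComplexScalars => fun z => complex.Im z
  end.

Definition sc_of_real : R -> K :=
  match s return R -> scalar_field R s with
  | RealScalars => id
  | ComplexScalars => fun r => (r%:C)%C
  end.

(* The norm of a numFieldType takes its values in the field itself; here it is
   brought back to R. *)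
Definition sc_abs (z : K) : R := sc_re `|z|.

End Scalars.

Section ScalarTheory.
Context {R : realType} {s : scalar_kind}.
Local Notation K := (scalar_field R s).
Implicit Types z w : K.

Lemma sc_reD z w : sc_re (z + w) = sc_re z + sc_re w.
Proof. by case: s z w => //= -[a b] [c d]. Qed.

Lemma sc_imD z w : sc_im (z + w) = sc_im z + sc_im w.
Proof. by case: s z w => //= [|[a b] [c d]] //; rewrite addr0. Qed.

Lemma sc_reM z w : sc_re (z * w) = sc_re z * sc_re w - sc_im z * sc_im w.
Proof. by case: s z w => //= [z w|[a b] [c d]] //; rewrite mul0r subr0. Qed.

Lemma sc_imM z w : sc_im (z * w) = sc_re z * sc_im w + sc_im z * sc_re w.
Proof. by case: s z w => //= [z w|[a b] [c d]] //; rewrite mulr0 mul0r addr0. Qed.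

Lemma sc_absE z : sc_abs z = Num.sqrt (sc_re z ^+ 2 + sc_im z ^+ 2).
Proof.
rewrite /sc_abs; case: s z => [z|[a b]] //=.
by rewrite expr0n/= addr0 sqrtr_sqr.
Qed.

Lemma sc_absK z : sc_of_real (sc_abs z) = `|z|.
Proof. by rewrite /sc_abs; case: s z => [z|[a b]]. Qed.

Lemma sc_abs_ge0 z : 0 <= sc_abs z.
Proof. by rewrite sc_absE sqrtr_ge0. Qed.

Lemma sc_abs0 : sc_abs (0 : K) = 0.
Proof. by rewrite /sc_abs normr0; case: s. Qed.

Lemma sc_abs_eq0 z : sc_abs z = 0 -> z = 0.
Proof.
move=> z0; apply/eqP; rewrite -normr_eq0 -sc_absK z0.
by rewrite /sc_of_real; case: (s).
Qed.

Lemma sc_of_realD (x y : R) :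
  sc_of_real (x + y) = sc_of_real x + sc_of_real y :> K.
Proof. by case: s => //=; rewrite rmorphD. Qed.

Lemma sc_of_realM (x y : R) :
  sc_of_real (x * y) = sc_of_real x * sc_of_real y :> K.
Proof. by case: s => //=; rewrite rmorphM. Qed.

Lemma ler_sc_of_real (x y : R) :
  ((sc_of_real x : K) <= sc_of_real y) = (x <= y).
Proof. by case: s => //=; rewrite lecR. Qed.

Lemma sc_of_real_inj : injective (sc_of_real : R -> K).
Proof. by case: s => [|] x y //= []. Qed.

Lemma sc_absD z w : sc_abs (z + w) <= sc_abs z + sc_abs w.
Proof.
by rewrite -(ler_sc_of_real) sc_of_realD !sc_absK ler_normD.
Qed.

Lemma sc_absM z w : sc_abs (z * w) = sc_abs z * sc_abs w.
Proof. by apply: sc_of_real_inj; rewrite sc_of_realM !sc_absK normrM. Qed.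

End ScalarTheory.

Section LpFunctions.
Context d (T : measurableType d) (R : realType) (s : scalar_kind).
Variables (mu : {measure set T -> \bar R}) (p : \bar R).
Local Notation K := (scalar_field R s).
Implicit Types f g : T -> K.

(* Borel measurability for scalar-valued functions, stated componentwise. *)
Definition sc_measurable f :=
  measurable_fun setT (sc_re \o f) /\ measurable_fun setT (sc_im \o f).

(* For p = +oo, 'N[mu]_p is the essential supremum (and 0 if mu = 0). *)
Definition sc_Lnorm f : \bar R := 'N[mu]_p[EFin \o (sc_abs \o f)]%E.

Definition Lp_pred : {pred T -> K} :=
  mem [set f | sc_measurable f /\ (sc_Lnorm f < +oo)%E].

Lemma measurable_sc_abs f :
  sc_measurable f -> measurable_fun setT (sc_abs \o f).
Proof.
move=> [mr mi].
rewrite (_ : _ \o _ =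
  Num.sqrt \o (fun x => (sc_re \o f) x ^+ 2 + (sc_im \o f) x ^+ 2)).
  apply: (measurableT_comp (continuous_measurable_fun (@sqrt_continuous R))).
  by apply: measurable_funD; exact: measurable_funX.
by apply/funext => x /=; rewrite sc_absE.
Qed.

Lemma sc_measurable0 : sc_measurable (0 : T -> K).
Proof.
split; [rewrite (_ : _ \o _ = cst (sc_re (0 : K)))//
       |rewrite (_ : _ \o _ = cst (sc_im (0 : K)))//];
exact: measurable_cst.
Qed.

Lemma sc_measurableD f g :
  sc_measurable f -> sc_measurable g -> sc_measurable (f + g).
Proof.
move=> [fr fi] [gr gi]; split.
  rewrite (_ : _ \o _ = (sc_re \o f) \+ (sc_re \o g)).
    exact: measurable_funD.
  by apply/funext => x /=; rewrite sc_reD.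
rewrite (_ : _ \o _ = (sc_im \o f) \+ (sc_im \o g)).
  exact: measurable_funD.
by apply/funext => x /=; rewrite sc_imD.
Qed.

Lemma sc_measurableZ (a : K) f : sc_measurable f -> sc_measurable (a *: f).
Proof.
move=> [fr fi]; split.
  rewrite (_ : _ \o _ =
      (fun x => sc_re a * (sc_re \o f) x - sc_im a * (sc_im \o f) x)).
    by apply: measurable_funB; apply: measurable_funM => //.
  by apply/funext => x /=; rewrite sc_reM.
rewrite (_ : _ \o _ =
    (fun x => sc_re a * (sc_im \o f) x + sc_im a * (sc_re \o f) x)).
  by apply: measurable_funD; apply: measurable_funM => //.
by apply/funext => x /=; rewrite sc_imM.
Qed.

Lemma le_Lnorm_EFin (f g : T -> R) : (0 < p)%E ->
    measurable_fun setT f -> measurable_fun setT g ->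
    (forall x, 0 <= f x <= g x) ->
  ('N[mu]_p[EFin \o f] <= 'N[mu]_p[EFin \o g])%E.
Proof.
move=> p0 mf mg fg; rewrite unlock /Lnorm.
have mE (h : T -> R) (r : R) : measurable_fun setT h ->
    measurable_fun setT (fun x => `|(EFin \o h) x| `^ r)%E.
  move=> mh; apply: (measurableT_comp (measurable_poweR _)).
  by apply: measurableT_comp => //; exact/measurable_EFinP.
have fgE x : (`|(EFin \o f) x| <= `|(EFin \o g) x|)%E.
  have /andP[f0 fgx] := fg x.
  by rewrite /= lee_fin !ger0_norm// (le_trans f0).
have le_poweR (r : R) (x y : \bar R) : (0 <= r)%R -> (0 <= x)%E ->
    (x <= y)%E -> (x `^ r <= y `^ r)%E.
  move=> r0 x0 xy; apply: gt0_ler_poweR => //; rewrite in_itv/= leey andbT//.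
  exact: le_trans xy.
case: p p0 => [r|_|//].
- rewrite lte_fin => r0; apply: (le_poweR).
  + by rewrite invr_ge0 ltW.
  + by apply: integral_ge0 => x _; exact: poweR_ge0.
  + apply: ge0_le_integral => //.
    * by move=> x _; exact: poweR_ge0.
    * exact: mE.
    * exact: mE.
    * by move=> x _; apply: (le_poweR); [exact: ltW|exact: abse_ge0|].
- by case: ifPn => // _; apply: le_ess_sup; apply: aeW => x; exact: fgE.
Qed.

Lemma sc_Lnorm_ge0 f : (0 <= sc_Lnorm f)%E.
Proof. exact: Lnorm_ge0. Qed.

Hypothesis p1 : (1 <= p)%E.

Lemma sc_LnormD f g : sc_measurable f -> sc_measurable g ->
  (sc_Lnorm (f + g)%R <= sc_Lnorm f + sc_Lnorm g)%E.
Proof.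
move=> mf mg; have p0 : (0 < p)%E by rewrite (lt_le_trans _ p1).
have mf' := measurable_sc_abs mf; have mg' := measurable_sc_abs mg.
apply: (@le_trans _ _
    ('N[mu]_p[EFin \o ((sc_abs \o f)%FUN \+ (sc_abs \o g)%FUN)%R])%E).
  apply: le_Lnorm_EFin => //.
  - exact/measurable_sc_abs/sc_measurableD.
  - exact: measurable_funD.
  - by move=> x /=; rewrite sc_abs_ge0 sc_absD.
exact: (eminkowski mu mf' mg' p1).
Qed.

Lemma sc_LnormZ (a : K) f : f \in Lp_pred ->
  sc_Lnorm (a *: f) = ((sc_abs a)%:E * sc_Lnorm f)%E.
Proof.
rewrite inE => -[mf nf].
have Lf : (sc_abs \o f) \in Lfun mu p.
  by rewrite inE/=; apply/andP; split; rewrite inE//=; exact: measurable_sc_abs.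
have := LnormZ (Lfun_Sub p1 Lf) (sc_abs a).
rewrite (ger0_norm (sc_abs_ge0 a)) /sc_Lnorm => <-.
by apply: eq_Lnorm => x /=; rewrite sc_absM.
Qed.

Lemma sc_Lnorm0 : sc_Lnorm (0 : T -> K) = 0%E.
Proof.
rewrite -[RHS](@Lnorm0 _ T R mu p) ?gt_eqF ?(lt_le_trans _ p1)//.
by apply: eq_Lnorm => x /=; rewrite sc_abs0.
Qed.

Lemma Lp_submod_closed : submod_closed Lp_pred.
Proof.
split.
  by rewrite inE; split; [exact: sc_measurable0|rewrite sc_Lnorm0].
move=> a f g /[dup] Lf /[!inE] -[mf nf] [mg ng].
have maf := sc_measurableZ a mf.
split; first exact: sc_measurableD.
rewrite (le_lt_trans (sc_LnormD maf mg))// lte_add_pinfty//.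
by rewrite sc_LnormZ// lte_mul_pinfty// lee_fin sc_abs_ge0.
Qed.

Lemma sc_Lnorm_eq0 f : sc_measurable f -> sc_Lnorm f = 0%E ->
  f = 0 %[ae mu].
Proof.
move=> /measurable_sc_abs mf.
have p0 : (0 < p)%E by rewrite (lt_le_trans _ p1).
have mf' : measurable_fun setT (EFin \o (sc_abs \o f)).
  exact/measurable_EFinP.
move=> /(Lnorm_eq0_eq0 mf' p0); apply: filterS => x /= /(_ I) + _.
by move=> [] /sc_abs_eq0.
Qed.

Lemma eq_sc_Lnorm f g : sc_measurable f -> sc_measurable g ->
  f = g %[ae mu] -> sc_Lnorm f = sc_Lnorm g.
Proof.
move=> /measurable_sc_abs mf /measurable_sc_abs mg fg.
rewrite /sc_Lnorm unlock /Lnorm.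
have fgE : \forall x \ae mu, `|(EFin \o (sc_abs \o f)) x|%E =
                             `|(EFin \o (sc_abs \o g)) x|%E.
  by apply: filterS fg => x /= /(_ I) ->.
case: p p1 => [r|_|//].
- move=> r1; congr poweR; apply: ae_eq_integral => //.
  + apply: (measurableT_comp (measurable_poweR _)).
    by apply: measurableT_comp => //; exact/measurable_EFinP.
  + apply: (measurableT_comp (measurable_poweR _)).
    by apply: measurableT_comp => //; exact/measurable_EFinP.
  + by apply: filterS fgE => x fgx _; congr poweR.
- by case: ifPn => // _; exact: eq_ess_sup.
Qed.

End LpFunctions.

Section LpFunSpace.
Context d (T : measurableType d) (R : realType) (s : scalar_kind).
Variables (mu : {measure set T -> \bar R}) (p : \bar R) (p1 : (1 <= p)%E).
Local Notation K := (scalar_field R s).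
Local Notation Lp_pred := (@Lp_pred d T R s mu p).

#[local] HB.instance Definition _ :=
  GRing.isSubmodClosed.Build _ _ Lp_pred (@Lp_submod_closed d T R s mu p p1).

(* The bound on p is a parameter of the type because the vector space structure
   needs it. *)
Record Lp_fun (q1 : (1 <= p)%E) := LpFun { Lp_val : T -> K ; _ : Lp_val \in Lp_pred }.
Local Notation FT := (Lp_fun p1).

HB.instance Definition _ := [isSub of FT for (@Lp_val p1)].
HB.instance Definition _ := [Choice of FT by <:].
HB.instance Definition _ := [SubChoice_isSubLmodule of FT by <:].

Lemma Lp_valD (f g : FT) x : Lp_val (f + g) x = Lp_val f x + Lp_val g x.
Proof. by []. Qed.

Lemma Lp_valN (f : FT) x : Lp_val (- f) x = - Lp_val f x.
Proof. by []. Qed.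

Lemma Lp_valZ (a : K) (f : FT) x : Lp_val (a *: f) x = a * Lp_val f x.
Proof. by []. Qed.

Lemma Lp_funP (f : FT) : Lp_val f \in Lp_pred.
Proof. exact: valP. Qed.

End LpFunSpace.

Section Lp.
Context d (T : measurableType d) (R : realType) (s : scalar_kind).
Variables (mu : {measure set T -> \bar R}) (p : \bar R) (p1 : (1 <= p)%E).
Local Notation K := (scalar_field R s).
Local Notation FT := (@Lp_fun d T R s mu p p1).
Implicit Types f g : FT.

Definition Lp_ae_eq f g := `[< Lp_val f = Lp_val g %[ae mu] >].

Lemma Lp_ae_eq_refl : reflexive Lp_ae_eq.
Proof. by move=> f; apply/asboolP; exact: ae_eq_refl. Qed.

Lemma Lp_ae_eq_sym : symmetric Lp_ae_eq.
Proof. by move=> f g; apply/idP/idP => /asboolP ?; exact/asboolP/ae_eq_sym. Qed.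

Lemma Lp_ae_eq_trans : transitive Lp_ae_eq.
Proof.
by move=> f g h /asboolP gf /asboolP fh; exact/asboolP/(ae_eq_trans gf fh).
Qed.

Canonical Lp_ae_eq_equiv :=
  EquivRel Lp_ae_eq Lp_ae_eq_refl Lp_ae_eq_sym Lp_ae_eq_trans.

Local Open Scope quotient_scope.

Definition Lp : Type := {eq_quot Lp_ae_eq}.
HB.instance Definition _ := Choice.on Lp.
HB.instance Definition _ := EqQuotient.on Lp.
Implicit Types u v w : Lp.

Lemma Lp_reprK f : Lp_val (repr (\pi_Lp f)) = Lp_val f %[ae mu].
Proof.
by apply/asboolP; rewrite -/(Lp_ae_eq _ _) -eqmodE reprK.
Qed.

Lemma eq_Lp f g : Lp_val f = Lp_val g %[ae mu] -> \pi_Lp f = \pi_Lp g.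
Proof. by move=> fg; apply/eqmodP/asboolP. Qed.

Definition Lp_zero : Lp := \pi_Lp 0.
Definition Lp_opp u : Lp := \pi_Lp (- repr u).
Definition Lp_add u v : Lp := \pi_Lp (repr u + repr v).
Definition Lp_scale (a : K) u : Lp := \pi_Lp (a *: repr u).
Definition Lp_norm u : K :=
  sc_of_real (fine (sc_Lnorm mu p (Lp_val (repr u)))).

Lemma Lp_pi_opp f : Lp_opp (\pi_Lp f) = \pi_Lp (- f).
Proof.
by apply: eq_Lp; apply: filterS (Lp_reprK f) => x fx ?; rewrite !Lp_valN fx.
Qed.

Lemma Lp_pi_add f g : Lp_add (\pi_Lp f) (\pi_Lp g) = \pi_Lp (f + g).
Proof.
apply: eq_Lp; apply: filterS2 (Lp_reprK f) (Lp_reprK g) => x fx gx ?.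
by rewrite !Lp_valD fx// gx.
Qed.

Lemma Lp_pi_scale a f : Lp_scale a (\pi_Lp f) = \pi_Lp (a *: f).
Proof.
by apply: eq_Lp; apply: filterS (Lp_reprK f) => x fx ?; rewrite !Lp_valZ fx.
Qed.

Lemma Lp_pi_norm f :
  Lp_norm (\pi_Lp f) = sc_of_real (fine (sc_Lnorm mu p (Lp_val f))).
Proof.
congr (sc_of_real (fine _)).
have /[!inE] -[mf _] := Lp_funP f.
have /[!inE] -[mr _] := Lp_funP (repr (\pi_Lp f)).
exact: (eq_sc_Lnorm p1 mr mf (Lp_reprK f)).
Qed.

Lemma Lp_addA : associative Lp_add.
Proof.
move=> u v w; elim/quotW: u => f; elim/quotW: v => g; elim/quotW: w => h.
by rewrite (Lp_pi_add g h) (Lp_pi_add f g) !Lp_pi_add addrA.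
Qed.

Lemma Lp_addC : commutative Lp_add.
Proof.
by move=> u v; elim/quotW: u => f; elim/quotW: v => g; rewrite !Lp_pi_add addrC.
Qed.

Lemma Lp_add0 : left_id Lp_zero Lp_add.
Proof. by move=> u; elim/quotW: u => f; rewrite Lp_pi_add add0r. Qed.

Lemma Lp_addN : left_inverse Lp_zero Lp_opp Lp_add.
Proof.
by move=> u; elim/quotW: u => f; rewrite (Lp_pi_opp f) Lp_pi_add addNr.
Qed.

HB.instance Definition _ :=
  GRing.isZmodule.Build Lp Lp_addA Lp_addC Lp_add0 Lp_addN.

Lemma Lp_scaleA a b u : Lp_scale a (Lp_scale b u) = Lp_scale (a * b) u.
Proof. by elim/quotW: u => f; rewrite (Lp_pi_scale b f) !Lp_pi_scale scalerA. Qed.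

Lemma Lp_scale1 : left_id 1 Lp_scale.
Proof. by move=> u; elim/quotW: u => f; rewrite Lp_pi_scale scale1r. Qed.

Lemma Lp_scaleDr : right_distributive Lp_scale +%R.
Proof.
move=> a u v; elim/quotW: u => f; elim/quotW: v => g.
rewrite -[LHS]/(Lp_scale a (Lp_add _ _)) (Lp_pi_add f g) !Lp_pi_scale.
by rewrite scalerDr -Lp_pi_add.
Qed.

Lemma Lp_scaleDl u : {morph Lp_scale^~ u : a b / a + b}.
Proof.
move=> a b; elim/quotW: u => f.
by rewrite !Lp_pi_scale scalerDl -Lp_pi_add.
Qed.

HB.instance Definition _ := GRing.Zmodule_isLmodule.Build K Lp
  Lp_scaleA Lp_scale1 Lp_scaleDr Lp_scaleDl.

Lemma fine_sc_Lnorm f :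
  (fine (sc_Lnorm mu p (Lp_val f)))%:E = sc_Lnorm mu p (Lp_val f).
Proof.
have /[!inE] -[_ nf] := Lp_funP f.
by rewrite fineK// ge0_fin_numE// sc_Lnorm_ge0.
Qed.

Lemma ler_Lp_normD u v : Lp_norm (u + v) <= Lp_norm u + Lp_norm v.
Proof.
elim/quotW: u => f; elim/quotW: v => g.
rewrite -[(_ + _ : Lp)]/(Lp_add _ _) Lp_pi_add !Lp_pi_norm -sc_of_realD.
rewrite ler_sc_of_real -lee_fin EFinD !fine_sc_Lnorm.
have /[!inE] -[mf _] := Lp_funP f.
have /[!inE] -[mg _] := Lp_funP g.
exact: (sc_LnormD mu p1 mf mg).
Qed.

Lemma Lp_normZ (a : K) u : Lp_norm (a *: u) = `|a| * Lp_norm u.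
Proof.
elim/quotW: u => f.
rewrite -[(_ *: _ : Lp)]/(Lp_scale _ _) Lp_pi_scale !Lp_pi_norm -sc_absK.
rewrite -sc_of_realM; congr sc_of_real; apply: EFin_inj.
by rewrite EFinM !fine_sc_Lnorm -(sc_LnormZ p1 a (Lp_funP f)).
Qed.

Lemma Lp_norm_eq0 u : Lp_norm u = 0 -> u = 0.
Proof.
elim/quotW: u => f; rewrite Lp_pi_norm => f0.
have {}f0 : fine (sc_Lnorm mu p (Lp_val f)) = 0.
  by apply: (@sc_of_real_inj R s); rewrite f0; case: (s).
apply: eq_Lp; have /[!inE] -[mf _] := Lp_funP f.
by apply: (sc_Lnorm_eq0 p1 mf); rewrite -fine_sc_Lnorm f0.
Qed.

HB.instance Definition _ :=
  Lmodule_isNormed.Build K Lp ler_Lp_normD Lp_normZ Lp_norm_eq0.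

End Lp.

Section Polarization.
Context {R : realType} {s : scalar_kind}.
Local Notation K := (scalar_field R s).
Variable X : normedModType K.

Definition unit_ball : set X := [set x | `|x| <= 1].

Section Forms.
Variable m : nat.
Implicit Type L : ('I_m -> X) -> K.

Definition is_multilinear L :=
  forall (i : 'I_m) (x : 'I_m -> X) (a : K) (u v : X),
    L [eta x with i |-> a *: u + v] =
    a * L [eta x with i |-> u] + L [eta x with i |-> v].

Definition is_symmetric L :=
  forall (t : {perm 'I_m}) (x : 'I_m -> X), L (x \o t) = L x.

Definition continuous_symmetric_multilinear L :=
  [/\ continuous (L : {ptws 'I_m -> X} -> K), is_multilinear L & is_symmetric L].

Definition form_norm L : \bar R :=
  ereal_sup [set (sc_abs (L x))%:E | x in [set x | forall i, unit_ball (x i)]].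

Definition hat L (x : X) : K := L (fun=> x).

Definition hat_norm L : \bar R :=
  ereal_sup [set (sc_abs (hat L x))%:E | x in unit_ball].

End Forms.

(* tagnat.sig1 maps the first k 0 indices to 0, the next k 1 indices to 1, and
   so on; hence L is evaluated with k i consecutive arguments equal to x i. *)
Definition mixed_value n (k : 'I_n -> nat)
    (L : ('I_(\sum_(i < n) k i) -> X) -> K) (x : 'I_n -> X) : K :=
  L (fun j => x (tagnat.sig1 j)).

Definition mixed_norm n (k : 'I_n -> nat)
    (L : ('I_(\sum_(i < n) k i) -> X) -> K) : \bar R :=
  ereal_sup [set (sc_abs (mixed_value L x))%:E
            | x in [set x : 'I_n -> X | forall i, unit_ball (x i)]].

(* The infimum is taken in \bar R, so that it is +oo if no M is admissible. *)
Definition polarization_const n (k : 'I_n -> nat) : \bar R :=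
  ereal_inf [set M%:E | M in [set M : R | 0 < M /\
    forall L : ('I_(\sum_(i < n) k i) -> X) -> K,
      continuous_symmetric_multilinear L ->
      (mixed_norm L <= M%:E * hat_norm L)%E]].

Definition polarization_const_full (m : nat) : \bar R :=
  ereal_inf [set M%:E | M in [set M : R | 0 < M /\
    forall L : ('I_m -> X) -> K,
      continuous_symmetric_multilinear L ->
      (form_norm L <= M%:E * hat_norm L)%E]].

End Polarization.

Arguments Lp {d T R} s mu {p} p1.
Arguments polarization_const {R s} X {n} k.
Arguments polarization_const_full {R s} X m.

(* Main.v *)
Require Import Defs.
From mathcomp Require Import all_boot all_order all_algebra.
From mathcomp Require Import fingroup perm generic_quotient.
From mathcomp Require Import all_classical all_reals all_analysis.
From mathcomp Require Import measurable_realfun.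
From mathcomp Require Import ring lra zify.

Set Implicit Arguments.
Unset Strict Implicit.
Unset Printing Implicit Defensive.

Import Order.TTheory GRing.Theory Num.Theory.
Import numFieldNormedType.Exports.

Local Open Scope classical_set_scope.
Local Open Scope ring_scope.

(** Fix points x_1, ..., x_n of the unit ball and map the real vector space
    R^n into X by a |-> sum_i a_i x_i. Suppose that R^n carries a positive
    semidefinite quadratic form q with q(e_i) <= 1, and that the image of the
    q-ball lies in the ball of radius d of X. Pulled back to R^n, a symmetric
    form L has diagonal values at most d^m ||hat L|| on the q-ball. By Banach's
    theorem, on a Euclidean space a symmetric form takes no larger values off
    the diagonal than on it; hence |L(x_1^k_1 ... x_n^k_n)| <= d^m ||hat L||
    (mixed_bound). So d^m bounds the polarization constant, and only d has to be
    made small. Real coefficients suffice over the complex numbers too: the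
    points x_i already lie in the real span, and one may replace L by the real
    part of c L, where c is a scalar of modulus at most one that turns the value
    under study into its absolute value.

    Banach's theorem (banach_polarization) is proved by rotating pairs of
    arguments. If B is a symmetric bilinear form with |B(u,u)| <= M on the unit
    ball, and e(t) runs over the unit circle of a plane, then
      B(e(c-t), e(c+t)) = cos^2 t B(e(c), e(c))
                          - sin^2 t B(e(c+pi/2), e(c+pi/2)).
    When the left side is within eps of M for some t <= pi/4, the two terms on
    the right are nearly extremal, and the value stays within 2 eps of M for
    every smaller t. Thus two arguments on an arc may be moved towards each
    other. Start from j copies of x and an argument y at angle th from x:
    moving each copy of x in turn forward by th/(j+1), and y back by as much each
    time, makes all of them equal; repeating this for one argument after another
    reaches the diagonal from a near-maximal tuple.

    The quadratic forms are explicit.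
    - In any space, q(a) = sum_i a_i^2 gives d = n^(1/2), by Cauchy-Schwarz; this
      covers L^oo.
    - In L^r with r finite, put W = sum_i |x_i|^r, so that the integral of W is
      at most n, and let Q(a) be the integral of |sum_i a_i x_i|^2 W^(1-2/r).
      For r <= 2, q = Q gives d = n^(1/r-1/2) (Lp_quadratic_le2). For r >= 2 put
      D = n^(1-2/r): both Q/D and the sum of squares are at most 1 at the e_i,
      the r-th power of the norm of sum_i a_i x_i is at most
      Q(a) (D |a|^2)^(r/2-1), and the weighted mean
      q(a) = (2/r) Q(a)/D + (1-2/r) |a|^2 gives d = n^(1/2-1/r)
      (Lp_quadratic_ge2).
    The exponents for L^r come from the weighted inequality between the
    arithmetic and geometric means, applied pointwise and then to integrals. *)

(** * Symmetric multilinear forms over a real quadratic space *)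

Definition upd m (V : Type) (z : 'I_m -> V) (i : 'I_m) (v : V) : 'I_m -> V :=
  fun j => if j == i then v else z j.

Lemma updC m (V : Type) (z : 'I_m -> V) (i j : 'I_m) (u v : V) : i != j ->
  upd (upd z i u) j v = upd (upd z j v) i u.
Proof.
move=> ij; apply/funext => k; rewrite /upd.
by case: (k =P i) => // ->; rewrite (negbTE ij).
Qed.

Section Banach.
Context {R : realType} (V : lmodType R).

Definition multilinear m (l : ('I_m -> V) -> R) :=
  forall i z (a : R) u v,
    l (upd z i (a *: u + v)) = a * l (upd z i u) + l (upd z i v).

Definition symmetric_form m (l : ('I_m -> V) -> R) :=
  forall (t : {perm 'I_m}) z, l (z \o t) = l z.

(** Quadraticity is expressed plane by plane, a form in which it is immediate for
    an integral. The coefficient c is twice the inner product of u and v. *)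
Definition psd_quadratic (q : V -> R) :=
  (forall v, 0 <= q v) /\
  forall u v, exists c, forall a b : R,
    q (a *: u + b *: v) = a ^+ 2 * q u + a * b * c + b ^+ 2 * q v.

(** The point at angle t on the ellipse with conjugate half-axes f and g. *)
Definition arc (f g : V) (t : R) : V := cos t *: f + sin t *: g.

Lemma arc_rotate (f g : V) (c t : R) :
  arc f g (c + t) = cos t *: arc f g c + sin t *: arc f g (c + pi / 2).
Proof.
rewrite /arc cosDpihalf sinDpihalf cosD sinD !scalerDr !scalerA !scalerBl !scalerDl.
rewrite mulrN scaleNr [sin t * sin c]mulrC [sin t * cos c]mulrC.
rewrite [cos t * cos c]mulrC [cos t * sin c]mulrC.
rewrite -!addrA; congr (_ + _).
by rewrite addrCA addrC -!addrA; congr (_ + _); rewrite addrC.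
Qed.

Section PairMove.
Variables (B : V -> V -> R) (q : V -> R) (M : R) (f g : V).
Hypothesis BDl : forall a u v w, B (a *: u + v) w = a * B u w + B v w.
Hypothesis BC : forall u v, B u v = B v u.
Hypothesis B_le : forall u, q u <= 1 -> `|B u u| <= M.
Hypothesis qfg : forall a b, q (a *: f + b *: g) <= a ^+ 2 + b ^+ 2.

Lemma q_arc t : q (arc f g t) <= 1.
Proof. by rewrite (le_trans (qfg _ _))// cos2Dsin2. Qed.

(** The arguments are cos t F -+ sin t G, and the cross terms cancel by
    symmetry. *)
Lemma pair_center c t : B (arc f g (c - t)) (arc f g (c + t)) =
  cos t ^+ 2 * B (arc f g c) (arc f g c) -
  sin t ^+ 2 * B (arc f g (c + pi / 2)) (arc f g (c + pi / 2)).
Proof.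
rewrite (arc_rotate _ _ c (- t)) (arc_rotate _ _ c t) cosN sinN.
move: (arc f g c) (arc f g (c + pi / 2)) => F G.
have B0 w : B 0 w = 0.
  by have := BDl 1 0 0 w; rewrite scaler0 addr0; lra.
have BZ a u w : B (a *: u) w = a * B u w by rewrite -[a *: u]addr0 BDl B0 addr0.
rewrite BDl BZ.
rewrite (BC F (_ + _)) (BC G (_ + _)) !BDl !BZ (BC G F). ring.
Qed.

(** With t the half-distance of the two angles, nearness to M bounds
    cos^2 t (M - B(F,F)) + sin^2 t (M + B(G,G)) by eps. Shrinking t multiplies the
    first weight by at most 1 / cos^2 t <= 2, because t <= pi/4, and decreases the
    second. *)
Lemma pair_move (a b tau eps : R) : 0 <= tau -> tau *+ 2 <= b - a ->
    b - a <= pi / 2 -> M - eps <= B (arc f g a) (arc f g b) ->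
  M - eps *+ 2 <= B (arc f g (a + tau)) (arc f g (b - tau)).
Proof.
rewrite mulr2n => tau0 taub bapi.
pose c : R := (a + b) / 2; pose t : R := (b - a) / 2; pose s : R := t - tau.
have -> : a = c - t by rewrite /c /t; field.
have -> : b = c + t by rewrite /c /t; field.
have -> : c - t + tau = c - s by rewrite /s; ring.
have -> : c + t - tau = c + s by rewrite /s; ring.
rewrite !pair_center.
have := B_le (q_arc c); rewrite ler_norml => /andP[_].
have := B_le (q_arc (c + pi / 2)); rewrite ler_norml => /andP[+ _].
set x := B _ _; set y := B _ _ => xM yM.
have pi0 := @pi_gt0 R.
have s0 : 0 <= s by rewrite /s /t; lra.
have st : s <= t by rewrite /s; lra.
have tpi : t <= pi / 4 by rewrite /t; lra.
clearbody c t s.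
have cost : 0 <= cos (t *+ 2).
  by apply: cos_ge0_pihalf; rewrite (mulr2n t); apply/andP; split; lra.
have : cos (t *+ 2) <= cos (s *+ 2).
  rewrite leNgt ltr_cos ?in_itv/= -?leNgt ?(mulr2n t) ?(mulr2n s); first lra.
    by apply/andP; split; lra.
  by apply/andP; split; lra.
move: cost; rewrite (mulr2n t) (mulr2n s) !cosD -!expr2 mulr2n.
have := cos2Dsin2 t; have := cos2Dsin2 s.
have := sqr_ge0 (sin s); have := sqr_ge0 (cos s).
move: (cos s ^+ 2) (cos t ^+ 2) (sin s ^+ 2) (sin t ^+ 2) => C c' S s'.
move=> C0 S0 CS cs c'0 cC hM.
have hy : 0 <= (2 * c' - C) * (M - y) by apply: mulr_ge0; lra.
have hx : 0 <= (2 * s' - S) * (M + x) by apply: mulr_ge0; lra.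
nra.
Qed.
End PairMove.

Section BanachTheorem.
Variables (m : nat) (l : ('I_m -> V) -> R) (q : V -> R) (M : R).
Hypothesis lL : multilinear l.
Hypothesis lS : symmetric_form l.
Hypothesis qP : psd_quadratic q.
Hypothesis l_le : forall z, (forall i, q (z i) <= 1) -> `|l z| <= M.

Lemma sym_updC (z : 'I_m -> V) (i j : 'I_m) u v : i != j ->
  l (upd (upd z i u) j v) = l (upd (upd z i v) j u).
Proof.
move=> ij; rewrite -(lS (tperm i j)); congr l; apply/funext => k /=.
rewrite /upd; case: tpermP => [->|->|/eqP ki /eqP kj].
- by rewrite eqxx (negbTE ij) eqxx.
- by rewrite (negbTE ij) !eqxx.
- by rewrite (negbTE ki) (negbTE kj).
Qed.

Lemma quad_scale a v : q (a *: v) = a ^+ 2 * q v.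
Proof.
have [_ /(_ v v)[c qc]] := qP; have := qc a 0.
by rewrite scale0r addr0 => ->; rewrite mulr0 mul0r expr0n mul0r !addr0.
Qed.

Lemma multilinear_scale (z : 'I_m -> V) i a v : l (upd z i (a *: v)) = a * l (upd z i v).
Proof.
have l0 : l (upd z i 0) = 0.
  by have := lL i z 1 0 0; rewrite scaler0 addr0; lra.
by rewrite -[a *: v]addr0 lL l0 addr0.
Qed.

Lemma ball_upd (z : 'I_m -> V) i v : (forall i, q (z i) <= 1) -> q v <= 1 ->
  forall j, q (upd z i v j) <= 1.
Proof. by move=> qz qv j; rewrite /upd; case: eqP. Qed.

(** All multiples of a null vector lie in the ball, where l is bounded. *)
Lemma null_vector (z : 'I_m -> V) i v : (forall i, q (z i) <= 1) -> q v = 0 ->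
  l (upd z i v) = 0.
Proof.
move=> qz qv; apply/eqP; apply: contraT => lv0.
have := l_le (ball_upd (z := z) i (v := ((M + 1) / l (upd z i v)) *: v) qz _).
rewrite quad_scale qv mulr0 => /(_ ler01).
by rewrite multilinear_scale divfK// => /ler_normlW; lra.
Qed.

(** Two vectors of the ball need not have norm 1, but x and y can be placed on an
    arc at angle acos c, where c is their inner product: in the plane of x and y,
    the Euclidean structure with |x| = |y| = 1 and inner product c dominates
    q. *)
Lemma plane_arc x y (c : R) : q x <= 1 -> q y <= 1 -> 0 <= c < 1 ->
    (forall a b : R, q (a *: x + b *: y) =
                     a ^+ 2 * q x + a * b * (c *+ 2) + b ^+ 2 * q y) ->
  exists f g th, [/\ 0 <= th <= pi / 2, arc f g 0 = x, arc f g th = y &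
    forall a b : R, q (a *: f + b *: g) <= a ^+ 2 + b ^+ 2].
Proof.
move=> qx qy /andP[c0 c1] qxy.
have c11 : -1 <= c <= 1 by apply/andP; split; lra.
pose s : R := sin (acos c).
have s_gt0 : 0 < s by rewrite /s sin_acos// sqrtr_gt0; nra.
have s2 : s ^+ 2 = 1 - c ^+ 2.
  by rewrite /s sin_acos// sqr_sqrtr//; nra.
have s0 : s != 0 by rewrite gt_eqF.
exists x, (s^-1 *: (y - c *: x)), (acos c); split.
- rewrite acos_ge0//= leNgt -ltr_cos ?in_itv/= ?acos_ge0 ?acos_lepi//.
    by rewrite cos_pihalf acosK ?in_itv//= -leNgt.
  by have := @pi_gt0 R => ?; apply/andP; split; lra.
- by rewrite /arc cos0 sin0 scale1r scale0r addr0.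
- rewrite /arc acosK ?in_itv// -/s scalerA divff// scale1r.
  by rewrite addrC subrK.
- move=> a b; have [d [dE bE]] : exists d, b / s = d /\ b = d * s.
    by exists (b / s); rewrite divfK.
  rewrite (_ : _ + _ = (a - d * c) *: x + d *: y); last first.
    rewrite scalerA dE scalerBr scalerBl scalerA -!addrA; congr (_ + _).
    by rewrite addrC.
  rewrite qxy bE exprMn s2 mulr2n.
  have h1 : 0 <= (a - d * c) ^+ 2 * (1 - q x).
    by apply: mulr_ge0; [exact: sqr_ge0|lra].
  have h2 : 0 <= d ^+ 2 * (1 - q y).
    by apply: mulr_ge0; [exact: sqr_ge0|lra].
  nra.
Qed.

Section Equalize.
Variables (f g : V) (th : R) (z : 'I_m -> V) (j : 'I_m).
Hypothesis qfg : forall a b : R, q (a *: f + b *: g) <= a ^+ 2 + b ^+ 2.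
Hypothesis thP : 0 <= th <= pi / 2.
Hypothesis qz : forall i, q (z i) <= 1.

Let tau : R := th / j.+1%:R.

(* mix k is the state after k pair moves: k copies of x have advanced by tau, and
   the j-th argument, which started at angle th, has moved back by k tau. *)
Let mix (k : nat) : 'I_m -> V := fun i =>
  if (i < k)%N then arc f g tau
  else if (i < j)%N then arc f g 0
  else if i == j then arc f g (th - k%:R * tau) else z i.

(** Each of the j moves costs a factor 2, whence eps 2^j. *)
Lemma equalize_arcs eps : M - eps <= l (mix 0) ->
  M - eps * 2 ^+ j <=
    l (fun i : 'I_m => if (i < j.+1)%N then arc f g tau else z i).
Proof.
move=> h0; have /andP[th0 thpi] := thP.
have tau0 : 0 <= tau by rewrite divr_ge0.
have jtau : j.+1%:R * tau = th by rewrite mulrC divfK// pnatr_eq0.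
have qmix k i : q (mix k i) <= 1.
  by rewrite /mix; do ![case: ifP => // _]; exact: q_arc.
suff H k : (k <= j)%N -> M - eps * 2 ^+ k <= l (mix k).
  rewrite (_ : (fun _ => _) = mix j) ?H//; apply/funext => i.
  rewrite /mix ltnS leq_eqVlt; case: ltnP; rewrite ?orbT// => ji.
  rewrite orbF -[X in X - _]jtau -mulrBl -natrB// subSnn mul1r.
  by rewrite -(inj_eq val_inj)/=; case: eqP.
elim: k => [_|k IHk kj]; first by rewrite expr0 mulr1.
have km : (k < m)%N by exact: ltn_trans kj (ltn_ord j).
pose kk := Ordinal km.
have kkj : kk != j by rewrite -(inj_eq val_inj)/= ltn_eqF.
pose B u v := l (upd (upd (mix k) kk u) j v).
have mixk : l (mix k) = B (arc f g 0) (arc f g (th - k%:R * tau)).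
  congr l; apply/funext => i; rewrite /upd /mix.
  case: (i =P j) => [->|/eqP ij].
    by rewrite ltnn ltnNge (ltnW kj).
  by case: (i =P kk) => [->|//]; rewrite /= ltnn kj.
have mixSk : l (mix k.+1) = B (arc f g (0 + tau)) (arc f g (th - k%:R * tau - tau)).
  congr l; apply/funext => i; rewrite /upd /mix add0r.
  case: (i =P j) => [->|/eqP ij].
    rewrite ltnn ltnNge kj/=; congr arc.
    by rewrite -[in LHS]natr1 mulrDl mul1r opprD addrA.
  case: (i =P kk) => [->|/eqP ik]; first by rewrite /= ltnSn.
  by rewrite ltnS leq_eqVlt -[(_ == k :> nat)]/(i == kk :> nat) (inj_eq val_inj) (negbTE ik).
rewrite mixSk exprSr mulrA mulr_natr.
apply: (@pair_move B q M f g) => //.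
- move=> a u v w; rewrite /B !(updC _ _ _ kkj) lL.
  by rewrite -!(updC _ _ _ kkj).
- by move=> u v; exact: sym_updC.
- by move=> u qu; apply: l_le; apply: ball_upd => //; exact: ball_upd.
- rewrite subr0 -[X in X - _]jtau -mulrBl -natrB; last by rewrite ltnW// ltnW.
  by rewrite -[tau *+ 2]mulr_natl ler_wpM2r// ler_nat; lia.
- by rewrite subr0; apply: le_trans thpi; rewrite gerBl mulr_ge0.
- by rewrite -mixk IHk// ltnW.
Qed.
End Equalize.

(** The supremum M of |l| need not be attained, so the passage to the diagonal
    works with tuples at which |l| is within eps of it. *)
Definition near_max (j : nat) (eps : R) := exists x z,
  [/\ q x <= 1, forall i, q (z i) <= 1 &
      M - eps <= `|l (fun i : 'I_m => if (i < j)%N then x else z i)|].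

End BanachTheorem.

Lemma multilinear_sign m (l : ('I_m -> V) -> R) (e : R) :
  multilinear l -> multilinear (fun z => e * l z).
Proof. by move=> lL i z a u v; rewrite lL mulrDr mulrCA. Qed.

(** The j-th entry y joins the common value x of the preceding ones. After a
    change of sign, y makes an acute angle with x, and equalize_arcs applies. *)
Lemma near_max_step m (l : ('I_m -> V) -> R) (q : V -> R) (M eps : R)
    (j : nat) :
  multilinear l -> symmetric_form l -> psd_quadratic q ->
  (forall z, (forall i, q (z i) <= 1) -> `|l z| <= M) ->
  (j < m)%N -> 0 <= eps ->
  near_max l q M j eps -> near_max l q M j.+1 (eps * 2 ^+ j).
Proof.
move=> lL lS qP l_le jm eps0 [x [z [qx qz hM]]].
pose jj := Ordinal jm; pose y := z jj.
pose w := fun i : 'I_m => if (i < j)%N then x else z i.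
have qw i : q (w i) <= 1 by rewrite /w; case: ifP.
have wy : w = upd w jj y.
  by apply/funext => i; rewrite /upd; case: eqP => // ->; rewrite /w ltnn.
have [q_ge0 qq] := qP; have [c' qxy] := qq x y.
have qy : q y <= 1 by exact: qz.
(* c is the inner product of x and y' = y or - y, with the sign that makes c
   nonnegative. *)
have [y' [c [qy' c01 qxy' ly']]] : exists y' c, [/\ q y' <= 1, 0 <= c <= 1,
    forall a b : R, q (a *: x + b *: y') =
                     a ^+ 2 * q x + a * b * (c *+ 2) + b ^+ 2 * q y' &
    `|l (upd w jj y')| = `|l w|].
  have c'1 : `|c'| <= 2.
    have := q_ge0 (1 *: x + 1 *: y); have := q_ge0 (1 *: x + (- 1) *: y).
    by rewrite !qxy ler_norml; move=> h1 h2; apply/andP; split; nra.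
  have [c'0|c'0] := leP 0 c'.
    exists y, (c' / 2); split=> //.
    - by move: c'1; rewrite ger0_norm// => ?; apply/andP; split; lra.
    - by move=> a b; rewrite qxy mulr2n; congr (_ + _ * _ + _); lra.
    - by rewrite -wy.
  exists (- 1 *: y), (- c' / 2); split=> //.
  - by rewrite (quad_scale qP) sqrrN expr1n mul1r.
  - by move: c'1; rewrite ltr0_norm// => ?; apply/andP; split; lra.
  - by move=> a b; rewrite scalerA qxy (quad_scale qP); field.
  - by rewrite (multilinear_scale lL) mulN1r normrN -wy.
have /andP[c0 c1] := c01.
move: (c1); rewrite le_eqVlt => /predU1P[c1E|c_lt1].
  (* Equality in Cauchy-Schwarz: y' - x is a null vector, so y' can be replaced
     by x. *)
  have qN : q (y' - x) = 0.
    have := q_ge0 (y' - x); have := qxy' (- 1) 1.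
    rewrite scaleN1r scale1r addrC => ->; rewrite c1E mulr2n => ?.
    by apply/eqP; rewrite eq_le; apply/andP; split; lra.
  exists x, z; split=> //.
  have -> : (fun i : 'I_m => if (i < j.+1)%N then x else z i) = upd w jj x.
    apply/funext => i; rewrite /upd /w ltnS leq_eqVlt.
    rewrite -[(_ == j :> nat)]/(i == jj :> nat) (inj_eq val_inj).
    by case: eqP.
  have : l (upd w jj y') = l (upd w jj x).
    rewrite -[y' in LHS](subrK x) -[y' - x]scale1r lL.
    by rewrite (null_vector lL qP l_le (z := w) jj (v := y' - x))// mulr0 add0r.
  move=> <-; rewrite ly'; apply: le_trans hM; rewrite lerB// ler_peMr//.
  by rewrite exprn_ege1// ler1n.
have c01' : 0 <= c < 1 by rewrite c0.
have [f [g [th [thP fx fy qfg]]]] := plane_arc qx qy' c01' qxy'.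
(* equalize_arcs needs a positive near-maximal value. *)
pose e := Num.sg (l (upd w jj y')).
have l'_le (v : 'I_m -> V) : (forall i, q (v i) <= 1) -> `|e * l v| <= M.
  move=> qv; rewrite normrM; apply: le_trans (l_le _ qv).
  by rewrite -[leRHS]mul1r ler_wpM2r// normr_sg lern1 leq_b1.
have l'S : symmetric_form (fun v => e * l v) by move=> t v; rewrite lS.
have := @equalize_arcs m (fun v => e * l v) q M (multilinear_sign e lL) l'S
  l'_le f g th z jj qfg thP qz eps.
rewrite /=.
set t0 := (X in l X); set t1 := (X in _ -> _ <= e * l X).
have -> : t0 = upd w jj y'.
  apply/funext => i; rewrite /t0 /upd /w fx mul0r subr0 fy.
  by case: (i =P jj) => [->|]; rewrite /= ?ltnn.
rewrite -normrEsg ly' => /(_ hM) h.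
exists (arc f g (th / j.+1%:R)), z; split=> //; first exact: q_arc.
apply: le_trans h _; apply: le_trans (ler_norm _) _.
by rewrite normrM ler_piMl// normr_sg lern1 leq_b1.
Qed.

(** Banach's theorem: on a real quadratic space, the supremum M of |l| over the
    ball is approached by tuples with more and more equal entries, finally by
    diagonal ones. *)
Theorem banach_polarization m (l : ('I_m -> V) -> R) (q : V -> R) (A C : R) :
  multilinear l -> symmetric_form l -> psd_quadratic q ->
  (forall z, (forall i, q (z i) <= 1) -> `|l z| <= C) ->
  (forall v, q v <= 1 -> `|l (fun=> v)| <= A) ->
  forall z, (forall i, q (z i) <= 1) -> `|l z| <= A.
Proof.
move=> lL lS qP l_le_C l_le_A z0 qz0.
pose S := [set `|l z| | z in [set z | forall i, q (z i) <= 1]].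
have S0 : has_sup S.
  split; first by exists `|l z0|, z0.
  by exists C => _ [z qz <-]; exact: l_le_C.
pose M := sup S.
have l_le z : (forall i, q (z i) <= 1) -> `|l z| <= M.
  by move=> qz; apply: sup_upper_bound => //; exists z.
have q0 : q 0 <= 1.
  have [_ /(_ 0 0)[c]] := qP; move=> /(_ 0 0).
  by rewrite !scale0r addr0 expr0n !mul0r !addr0 => ->.
have near0 eps : 0 < eps -> near_max l q M 0 eps.
  move=> eps0; have [_ [z qz <-] hz] := sup_adherent eps0 S0.
  by exists 0, z; split=> //; exact: ltW.
have near j : (j <= m)%N -> forall eps, 0 < eps -> near_max l q M j eps.
  elim: j => [_|j IHj jm eps eps0]; first exact: near0.
  have p0 : 0 < 2 ^+ j :> R by rewrite exprn_gt0.
  rewrite -[eps](divfK (lt0r_neq0 p0)); apply: near_max_step => //.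
    by rewrite ltW// divr_gt0.
  by apply: IHj; [exact: ltnW|rewrite divr_gt0].
apply: le_trans (l_le _ qz0) _; apply/ler_addgt0Pr => eps eps0.
have [x [z [qx qz]]] := near _ (leqnn m) _ eps0.
rewrite (_ : (fun _ => _) = fun=> x); last by apply/funext => i; rewrite ltn_ord.
by have := l_le_A _ qx; lra.
Qed.

End Banach.
(** * Real-valued norms and phases *)

Section ScalarFacts.
Context {R : realType} {s : scalar_kind}.
Local Notation K := (scalar_field R s).

Lemma sc_of_real1 : sc_of_real 1 = 1 :> K.
Proof. by case: s. Qed.

Lemma sc_of_real_abs (z : K) : 0 <= z -> sc_of_real (sc_abs z) = z.
Proof. by move=> z0; rewrite sc_absK ger0_norm. Qed.

Lemma sc_re_of_realM (a : R) (z : K) : sc_re (sc_of_real a * z) = a * sc_re z.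
Proof. by rewrite sc_reM; case: s z => [|] z /=; rewrite mul0r subr0. Qed.

Lemma le_sc_re_abs (z : K) : `|sc_re z| <= sc_abs z.
Proof.
rewrite sc_absE -sqrtr_sqr ler_sqrt ?lerDl ?sqr_ge0//.
by rewrite addr_ge0 ?sqr_ge0.
Qed.

Lemma sc_abs_of_real (a : R) : sc_abs (sc_of_real a : K) = `|a|.
Proof.
by rewrite sc_absE; case: s => /=; rewrite expr0n/= addr0 sqrtr_sqr.
Qed.

Lemma exists_phase (w : K) : exists c : K, sc_abs c <= 1 /\ sc_re (c * w) = sc_abs w.
Proof.
have [->|w0] := eqVneq w 0.
  by exists 0; rewrite mulr0 sc_abs0; split=> //; case: s.
exists (`|w| / w); rewrite divfK//; split=> //.
have w0' : sc_abs w != 0 by apply: contra w0 => /eqP/sc_abs_eq0 ->.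
rewrite -(@ler_pM2r _ (sc_abs w)) ?lt0r ?w0' ?sc_abs_ge0//.
rewrite -sc_absM divfK// mul1r -(ler_sc_of_real (s := s)) !sc_absK.
by rewrite normr_id.
Qed.

Section Norm.
Variable X : normedModType K.

(** The norm of a normed module over K takes its values in K. *)
Definition rnorm (x : X) : R := sc_abs (`|x| : K).

Lemma rnormK x : sc_of_real (rnorm x) = `|x|.
Proof. by rewrite /rnorm sc_absK normr_id. Qed.

Lemma rnormZ (a : K) x : rnorm (a *: x) = sc_abs a * rnorm x.
Proof. by apply: (@sc_of_real_inj R s); rewrite sc_of_realM !rnormK sc_absK normrZ. Qed.

Lemma rnormD x y : rnorm (x + y) <= rnorm x + rnorm y.
Proof.
by rewrite -(ler_sc_of_real (s := s)) sc_of_realD !rnormK ler_normD.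
Qed.

Lemma rnorm_sum (I : Type) (r : seq I) (F : I -> X) :
  rnorm (\sum_(i <- r) F i) <= \sum_(i <- r) rnorm (F i).
Proof.
elim: r => [|i r IH].
  by rewrite !big_nil /rnorm normr0 sc_abs0.
by rewrite !big_cons (le_trans (rnormD _ _))// lerD2l.
Qed.

Lemma unit_ballE x : unit_ball x <-> rnorm x <= 1.
Proof.
by rewrite /unit_ball/= -rnormK -sc_of_real1 ler_sc_of_real.
Qed.
End Norm.
End ScalarFacts.

(** * From a quadratic form on the coefficients to a bound on mixed values *)

Section Core.
Context {R : realType} {s : scalar_kind}.
Local Notation K := (scalar_field R s).
Variable X : normedModType K.

Lemma multilinear_scale_all m (L : ('I_m -> X) -> K) (a : K) (z : 'I_m -> X) :
  is_multilinear L -> L (fun i => a *: z i) = a ^+ m * L z.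
Proof.
move=> lL.
have l0 x i : L (upd x i 0) = 0.
  have := lL i x 1 0 0; rewrite scaler0 addr0 mul1r => /eqP.
  by rewrite -[X in X == _]addr0 (inj_eq (addrI _)) => /eqP <-.
suff H j : (j <= m)%N ->
    L (fun i : 'I_m => if (i < j)%N then a *: z i else z i) = a ^+ j * L z.
  rewrite -H//; congr L; apply/funext => i; by rewrite ltn_ord.
elim: j => [_|j IHj jm]; first by rewrite expr0 mul1r.
pose w (i : 'I_m) := if (i < j)%N then a *: z i else z i.
pose jj := Ordinal jm.
rewrite (_ : (fun _ => _) = upd w jj (a *: z jj + 0)).
  rewrite [LHS]lL -[X in _ + X]/(L (upd w jj 0)) l0 addr0 exprS -mulrA -IHj 1?ltnW//.
  congr (_ * L _); apply/funext => i /=; case: eqP => // ->.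
  by rewrite /= ltnn.
apply/funext => i; rewrite /upd /w addr0 ltnS leq_eqVlt.
rewrite -[(_ == j :> nat)]/(i == jj :> nat) (inj_eq val_inj).
by case: eqP => [->|].
Qed.

(** The sets of tuples with all entries of norm < r form a filter base that
    converges pointwise to 0, so continuity of L at 0 bounds L on one of them. *)
Lemma continuous_locally_bounded m (L : ('I_m -> X) -> K) :
  continuous (L : {ptws 'I_m -> X} -> K) ->
  exists2 r : R, 0 < r & exists C : R, forall z,
    (forall i, rnorm (z i) < r) -> sc_abs (L z) <= C.
Proof.
move=> Lc.
pose N (r : R) := [set z : 'I_m -> X | forall i, rnorm (z i) < r].
pose G := filter_from [set r : R | 0 < r] N.
have GF : Filter G.
  apply: filter_from_filter; first by exists 1 => /=.
  move=> r t /= r0 t0; exists (Num.min r t); first by rewrite /= lt_min r0.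
  by move=> z zrt; split=> i; have := zrt i; rewrite lt_min => /andP[].
have G0 : G --> ((fun=> 0) : {ptws 'I_m -> X}).
  apply/cvg_sup => i U [V] [[W] oW <-] W0 WU.
  apply: (filterS WU).
  have /nbhs_norm0P[e /= e0 eW] : nbhs (0 : X) W by exact: open_nbhs_nbhs.
  have e'0 : 0 < sc_abs e.
    by rewrite lt0r sc_abs_ge0 andbT; apply: contraTN e0 => /eqP/sc_abs_eq0 ->; rewrite ltxx.
  exists (sc_abs e) => // z /(_ i) ze; apply: eW => /=.
  rewrite -(sc_of_real_abs (ltW e0)) -rnormK lt_neqAle ler_sc_of_real ltW// andbT.
  by apply: contraTN ze => /eqP/sc_of_real_inj ->; rewrite ltxx.
have : G [set z | `|L (fun=> 0) - L z| < 1].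
  have := Lc (fun=> 0); move=> /cvgrPdist_lt/(_ 1 ltr01) /= h.
  exact: G0 h.
case=> r /= r0 hr; exists r => //; exists (sc_abs (L (fun=> 0)) + 1) => z zr.
rewrite -[L z](subKr (L (fun=> 0))); apply: le_trans (sc_absD _ _) _.
rewrite lerD2l.
rewrite -(ler_sc_of_real (s := s)) sc_absK normrN sc_of_real1; apply/ltW.
exact: hr zr.
Qed.

(** The coefficients are real even when K is complex, so that Banach's theorem
    over R applies on the space of coefficients. *)
Definition comb n (x : 'I_n -> X) (a : 'rV[R]_n) : X :=
  \sum_i sc_of_real (a 0 i) *: x i.

Lemma comb_linear n (x : 'I_n -> X) (a : R) u v :
  comb x (a *: u + v) = sc_of_real a *: comb x u + comb x v.
Proof.
rewrite /comb scaler_sumr -big_split/=; apply: eq_bigr => i _.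
by rewrite !mxE sc_of_realD sc_of_realM scalerDl scalerA.
Qed.

Lemma comb_delta n (x : 'I_n -> X) i : comb x (delta_mx 0 i) = x i.
Proof.
rewrite /comb (bigD1 i)//= mxE !eqxx sc_of_real1 scale1r big1 ?addr0// => j ji.
rewrite mxE (negbTE ji) andbF [sc_of_real _](_ : _ = 0) ?scale0r//.
by case: s.
Qed.

(** Banach's theorem for the real part of c L(u a_1, ..., u a_m), where u maps a to
    comb x a and c makes the value at (x o sigma) real and nonnegative. *)
Lemma mixed_bound m (L : ('I_m -> X) -> K) n (x : 'I_n -> X)
    (sigma : 'I_m -> 'I_n) (q : 'rV[R]_n -> R) (d A : R) :
  continuous_symmetric_multilinear L ->
  psd_quadratic q -> (forall i, q (delta_mx 0 i) <= 1) ->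
  0 < d -> (forall a, q a <= 1 -> rnorm (comb x a) <= d) ->
  (forall y, unit_ball y -> sc_abs (hat L y) <= A) ->
  sc_abs (L (x \o sigma)) <= d ^+ m * A.
Proof.
move=> [Lc lL lS] qP q1 d0 qd LA.
have [r r0 [C LC]] := continuous_locally_bounded Lc.
have sd a : sc_abs (sc_of_real a ^+ m : K) = `|a| ^+ m.
  elim: m {L sigma Lc lL lS LA LC} => [|k IH]; last by rewrite !exprS sc_absM IH sc_abs_of_real.
  by rewrite !expr0 -sc_of_real1 sc_abs_of_real normr1.
have [c [c1 cL]] := exists_phase (L (x \o sigma)).
pose l (v : 'I_m -> 'rV[R]_n) := sc_re (c * L (comb x \o v)).
have l_le v : `|l v| <= sc_abs (L (comb x \o v)).
  apply: le_trans (le_sc_re_abs _) _; rewrite sc_absM.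
  by rewrite ler_piMl// sc_abs_ge0.
pose t := r / (d *+ 2).
have t0 : 0 < t by rewrite divr_gt0// mulrn_wgt0.
have td : t * d < r.
  have -> : t * d = r / 2 by rewrite /t; field; rewrite gt_eqF.
  by rewrite ltr_pdivrMr// ltr_pMr// ltr1n.
have -> : sc_abs (L (x \o sigma)) = l (fun i => delta_mx 0 (sigma i)).
  rewrite -cL /l; congr (sc_re (c * L _)); apply/funext => i /=.
  by rewrite comb_delta.
apply: le_trans (ler_norm _) _.
apply: (@banach_polarization _ _ _ l q (d ^+ m * A) (C / t ^+ m)) => //.
- move=> i z a u v; rewrite -sc_re_of_realM -sc_reD mulrCA -mulrDr; congr (sc_re (c * _)).
  have E w : comb x \o upd z i w = upd (comb x \o z) i (comb x w).
    by apply/funext => j; rewrite /upd/=; case: eqP.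
  by rewrite !E comb_linear [LHS]lL.
- by move=> p v; rewrite /l -(lS p (comb x \o v)).
- move=> z qz; apply: le_trans (l_le z) _.
  rewrite ler_pdivlMr ?exprn_gt0//.
  have := multilinear_scale_all (sc_of_real t) (comb x \o z) lL.
  move=> /(congr1 sc_abs); rewrite sc_absM sd gtr0_norm// mulrC => <-.
  apply: LC => i; rewrite rnormZ sc_abs_of_real gtr0_norm//.
  by apply: le_lt_trans td; rewrite ler_pM2l// qd.
- move=> v qv; apply: le_trans (l_le _) _.
  have dd : (sc_of_real d : K) * sc_of_real d^-1 = 1.
    by rewrite -sc_of_realM divff ?gt_eqF// sc_of_real1.
  have -> : comb x \o (fun=> v) =
      (fun _ : 'I_m => sc_of_real d *: (sc_of_real d^-1 *: comb x v)).
    by apply/funext => i /=; rewrite scalerA dd scale1r.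
  rewrite (@multilinear_scale_all m L (sc_of_real d) (fun=> sc_of_real d^-1 *: comb x v) lL).
  rewrite sc_absM sd gtr0_norm// ler_pM2l ?exprn_gt0//; apply: LA; apply/unit_ballE.
  rewrite rnormZ sc_abs_of_real gtr0_norm ?invr_gt0// mulrC ler_pdivrMr// mul1r.
  exact: qd.
Qed.
End Core.
(** * Inequalities between sums and means *)

Section Elementary.
Context {R : realType}.

Lemma cauchy_schwarz_sum n (a b : 'I_n -> R) :
  (\sum_i a i * b i) ^+ 2 <= (\sum_i a i ^+ 2) * \sum_i b i ^+ 2.
Proof.
set P := \sum_i _; set S := \sum_i a i ^+ 2; set Q := \sum_i b i ^+ 2.
have Q0 : 0 <= Q by apply: sumr_ge0 => i _; exact: sqr_ge0.
have := Q0; rewrite le_eqVlt => /predU1P[/esym Q0'|Qp].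
  have b0 i : b i = 0.
    have /(_ i isT)/eqP := psumr_eq0P (fun i _ => sqr_ge0 (b i)) Q0'.
    by rewrite sqrf_eq0 => /eqP.
  rewrite /P big1 ?expr0n/= ?Q0' ?mulr0// => i _; by rewrite b0 mulr0.
have : 0 <= \sum_i (Q * a i - P * b i) ^+ 2 by apply: sumr_ge0 => i _; exact: sqr_ge0.
rewrite (_ : \sum_i _ = Q * (S * Q - P ^+ 2)); first by rewrite pmulr_rge0// subr_ge0.
rewrite (eq_bigr (fun i => Q ^+ 2 * a i ^+ 2 + - (2 * Q * P) * (a i * b i) +
  P ^+ 2 * b i ^+ 2)); last by move=> i _; ring.
rewrite !big_split/= -!mulr_sumr -/P -/S -/Q; ring.
Qed.

Lemma weighted_AMGM (t a b : R) : 0 <= t <= 1 -> 0 <= a -> 0 <= b ->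
  a `^ t * b `^ (1 - t) <= t * a + (1 - t) * b.
Proof.
move=> /andP[t0 t1] a0 b0.
move: t0 t1; rewrite le_eqVlt => /predU1P[<- _|t0].
  by rewrite powRr0 subr0 powRr1// !mul1r mul0r add0r.
rewrite le_eqVlt => /predU1P[->|t1].
  by rewrite subrr powRr0 powRr1// mulr1 !mul1r mul0r addr0.
have t'0 : 0 < 1 - t by rewrite subr_gt0.
have := @conjugate_powR R (a `^ t) (b `^ (1 - t)) t^-1 (1 - t)^-1.
rewrite !powR_ge0 !invr_gt0 !invrK => /(_ isT isT t0 t'0).
rewrite addrC subrK => /(_ erefl).
by rewrite -!powRrM !divff ?gt_eqF// !powRr1// (mulrC a t) (mulrC b).
Qed.

(** Weights that are balanced when a : b = 1 : N; this is where the powers of n in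
    the final bounds come from. *)
Lemma weighted_AMGM_scaled (t N a b : R) : 0 <= t <= 1 -> 0 < N -> 0 <= a -> 0 <= b ->
  a `^ t * b `^ (1 - t) <= t * N `^ (1 - t) * a + (1 - t) * N `^ (- t) * b.
Proof.
move=> t01 N0 a0 b0.
have := @weighted_AMGM t (N `^ (1 - t) * a) (N `^ (- t) * b) t01.
rewrite !mulr_ge0 ?powR_ge0// => /(_ isT isT).
rewrite !mulrA => /(le_trans _); apply.
rewrite powRM ?powR_ge0// -[X in _ <= X]mulrA powRM ?powR_ge0// -!powRrM.
rewrite [X in _ <= X](_ : _ = N `^ ((1 - t) * t) * N `^ (- t * (1 - t)) *
  (a `^ t * b `^ (1 - t))); last by ring.
rewrite -powRD; last by rewrite (gt_eqF N0) implybT.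
have -> : (1 - t) * t + - t * (1 - t) = 0 by ring.
by rewrite powRr0 mul1r.
Qed.
End Elementary.

(** * Polarization constants *)

Section PolarizationConstants.
Context {R : realType} {s : scalar_kind}.
Local Notation K := (scalar_field R s).
Variable X : normedModType K.

(** A weakening of the existence of a Euclidean norm at distance d from the norm
    of the span: the form is bounded from above at the points x_i only, so that
    it can be written down explicitly instead of being found as an extremal
    ellipsoid. *)
Definition euclidean_bound n (x : 'I_n -> X) (d : R) :=
  exists q : 'rV[R]_n -> R, [/\ psd_quadratic q,
    forall i, q (delta_mx 0 i) <= 1 & forall a, q a <= 1 -> rnorm (comb x a) <= d].

Lemma hat_norm_le m (L : ('I_m -> X) -> K) (A : R) :
  hat_norm L = A%:E -> forall y, unit_ball y -> sc_abs (hat L y) <= A.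
Proof.
move=> LA y y1; rewrite -lee_fin -LA; apply: ereal_sup_ubound.
by exists y.
Qed.

(** The map sigma covers both constants: it is tagnat.sig1 for the mixed values
    and the identity for the norm of L. *)
Lemma sup_le_hat_norm m (L : ('I_m -> X) -> K) n (sigma : 'I_m -> 'I_n) (d : R) :
  0 < d -> continuous_symmetric_multilinear L ->
  (forall x : 'I_n -> X, (forall i, unit_ball (x i)) -> euclidean_bound x d) ->
  (ereal_sup [set (sc_abs (L (x \o sigma)))%:E
     | x in [set x : 'I_n -> X | forall i, unit_ball (x i)]] <=
   (d ^+ m)%:E * hat_norm L)%E.
Proof.
move=> d0 Lc xd; apply: ge_ereal_sup => _ [x x1 <-].
have [q [qP q1 qd]] := xd x x1.
case E : (hat_norm L) => [A| |].
- rewrite -EFinM lee_fin; apply: mixed_bound qP q1 d0 qd _ => //.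
  exact: hat_norm_le.
- by rewrite gt0_muley ?leey// lte_fin exprn_gt0.
- have : (-oo < hat_norm L)%E; last by rewrite E.
  apply: (@lt_le_trans _ _ (sc_abs (hat L 0))%:E); first exact: ltNyr.
  by apply: ereal_sup_ubound; exists 0; rewrite // /unit_ball/= normr0.
Qed.

Lemma polarization_const_le n (k : 'I_n -> nat) (d : R) : 0 < d ->
  (forall x : 'I_n -> X, (forall i, unit_ball (x i)) -> euclidean_bound x d) ->
  (polarization_const X k <= (d ^+ (\sum_(i < n) k i))%:E)%E.
Proof.
move=> d0 xd; apply: ereal_inf_lbound; exists (d ^+ (\sum_(i < n) k i)) => //.
split; first exact: exprn_gt0.
move=> L Lc; exact: (sup_le_hat_norm (@tagnat.sig1 _ k) d0 Lc xd).
Qed.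

Lemma polarization_const_full_le m (d : R) : 0 < d ->
  (forall x : 'I_m -> X, (forall i, unit_ball (x i)) -> euclidean_bound x d) ->
  (polarization_const_full X m <= (d ^+ m)%:E)%E.
Proof.
move=> d0 xd; apply: ereal_inf_lbound; exists (d ^+ m) => //.
split; first exact: exprn_gt0.
move=> L Lc; exact: (sup_le_hat_norm id d0 Lc xd).
Qed.
End PolarizationConstants.

(** * The sum of squares, for an arbitrary normed space *)

Section SumSquares.
Context {R : realType}.

Definition sum_squares n (a : 'rV[R]_n) : R := \sum_i a 0 i ^+ 2.

Lemma psd_sum_squares n : psd_quadratic (@sum_squares n).
Proof.
split=> [v|u v]; first by apply: sumr_ge0 => i _; exact: sqr_ge0.
exists (2 * \sum_i u 0 i * v 0 i) => a b.
rewrite /sum_squares mulrA !mulr_sumr -!big_split/=; apply: eq_bigr => i _.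
rewrite !mxE; ring.
Qed.

Lemma sum_squares_delta n (i : 'I_n) : sum_squares (delta_mx 0 i) = 1.
Proof.
rewrite /sum_squares (bigD1 i)//= mxE !eqxx big1 ?addr0 ?expr1n// => j ji.
by rewrite mxE (negbTE ji) andbF expr0n.
Qed.

Lemma euclidean_bound_sqrt (s : scalar_kind) (X : normedModType (scalar_field R s)) n
    (x : 'I_n -> X) : (forall i, unit_ball (x i)) ->
  euclidean_bound x (n%:R `^ (2^-1)).
Proof.
move=> x1; exists (@sum_squares n); split; first exact: psd_sum_squares.
  by move=> i; rewrite sum_squares_delta.
move=> a qa; rewrite powR12_sqrt//.
have : rnorm (comb x a) <= \sum_i `|a 0 i| * 1.
  apply: le_trans (rnorm_sum _ _) _; apply: ler_sum => i _.
  by rewrite rnormZ sc_abs_of_real ler_wpM2l//; exact/unit_ballE.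
move=> /le_trans; apply; rewrite -ler_sqr ?nnegrE ?sqrtr_ge0//; last first.
  by apply: sumr_ge0 => i _; rewrite mulr1.
rewrite sqr_sqrtr//; apply: le_trans (cauchy_schwarz_sum _ _) _.
rewrite (eq_bigr (fun i => a 0 i ^+ 2)); last by move=> i _; rewrite real_normK// num_real.
rewrite [X in _ * X](_ : _ = n%:R); first by rewrite ler_piMl.
by rewrite (eq_bigr (fun=> 1)) ?sumr_const ?card_ord// => i _; rewrite expr1n.
Qed.
End SumSquares.
(** * Weighted L^2 forms *)

Section WeightedL2.
Context {R : realType} {s : scalar_kind} d (T : measurableType d).
Variable mu : {measure set T -> \bar R}.
Local Notation K := (scalar_field R s).

Lemma psd_lin (V : lmodType R) (q1 q2 : V -> R) (a1 a2 : R) :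
  0 <= a1 -> 0 <= a2 -> psd_quadratic q1 -> psd_quadratic q2 ->
  psd_quadratic (fun v => a1 * q1 v + a2 * q2 v).
Proof.
move=> a10 a20 [q1_ge0 q1P] [q2_ge0 q2P]; split=> [v|u v].
  by rewrite addr_ge0 ?mulr_ge0.
have [c1 E1] := q1P u v; have [c2 E2] := q2P u v.
by exists (a1 * c1 + a2 * c2) => a b; rewrite E1 E2; ring.
Qed.

Lemma sc_abs_sqr (z : K) : sc_abs z ^+ 2 = sc_re z ^+ 2 + sc_im z ^+ 2.
Proof. by rewrite sc_absE sqr_sqrtr// addr_ge0 ?sqr_ge0. Qed.

Lemma sc_im_of_realM (a : R) (z : K) : sc_im (sc_of_real a * z) = a * sc_im z.
Proof. by rewrite sc_imM; case: s z => [|] z /=; rewrite ?mulr0 mul0r addr0. Qed.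

Lemma psd_weighted_L2 (V : lmodType R) (y : V -> T -> K) (h : T -> R) :
  (forall a b u v t,
    y (a *: u + b *: v) t = sc_of_real a * y u t + sc_of_real b * y v t) ->
  (forall v, sc_measurable (y v)) -> measurable_fun setT h ->
  (forall t, 0 <= h t) ->
  (forall v, mu.-integrable setT (EFin \o (fun t => sc_abs (y v t) ^+ 2 * h t))) ->
  psd_quadratic (fun v => \int[mu]_t (sc_abs (y v t) ^+ 2 * h t))%R.
Proof.
move=> yL ym hm h0 yi; split=> [v|u v].
  by apply: Rintegral_ge0 => t _; rewrite mulr_ge0 ?sqr_ge0.
pose c t := (sc_re (y u t) * sc_re (y v t) + sc_im (y u t) * sc_im (y v t)) * h t.
have ci : mu.-integrable setT (EFin \o c).
  apply: (le_integrable measurableT _ _ (integrableD measurableT (yi u) (yi v))).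
    apply/measurable_EFinP; apply: measurable_funM => //.
    have [ur ui] := ym u; have [vr vi] := ym v.
    by apply: measurable_funD; apply: measurable_funM.
  move=> t _; rewrite /= lee_fin -mulrDl !normrM (ger0_norm (h0 t)).
  apply: ler_wpM2r => //; rewrite [leRHS]ger0_norm ?addr_ge0 ?sqr_ge0// !sc_abs_sqr.
  set p := sc_re (y u t); set p' := sc_im (y u t).
  set z := sc_re (y v t); set z' := sc_im (y v t).
  have := sqr_ge0 (p - z); have := sqr_ge0 (p' - z').
  have := sqr_ge0 (p + z); have := sqr_ge0 (p' + z').
  by rewrite ler_norml => ? ? ? ?; apply/andP; split; nra.
exists (2 * \int[mu]_t c t)%R => a b.
have iZ (e : R) (g : T -> R) : mu.-integrable setT (EFin \o g) ->
    mu.-integrable setT (EFin \o (fun t => e * g t)).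
  move=> gi; rewrite (_ : _ \o _ = (fun t => e%:E * (EFin \o g) t)%E).
    exact: integrableZl.
  by apply/funext => t /=; rewrite EFinM.
have iD (g1 g2 : T -> R) : mu.-integrable setT (EFin \o g1) ->
    mu.-integrable setT (EFin \o g2) ->
    mu.-integrable setT (EFin \o (fun t => g1 t + g2 t)).
  move=> i1 i2; rewrite (_ : _ \o _ = (EFin \o g1) \+ (EFin \o g2))%E.
    exact: integrableD.
  by apply/funext => t /=; rewrite EFinD.
rewrite (@eq_Rintegral _ _ _ _ _ (fun t => (a ^+ 2 * (sc_abs (y u t) ^+ 2 * h t) +
    (2 * (a * b)) * c t) + b ^+ 2 * (sc_abs (y v t) ^+ 2 * h t))).
  rewrite RintegralD//; [|by apply: iD; apply: iZ|exact: iZ].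
  rewrite RintegralD//; [|exact: iZ|exact: iZ].
  by rewrite !RintegralZl//; ring.
move=> t _; rewrite yL !sc_abs_sqr sc_reD sc_imD !sc_re_of_realM !sc_im_of_realM /c; ring.
Qed.

(** Turns a pointwise instance of the weighted AM-GM inequality into an inequality
    of integrals. *)
Lemma integral_le_lin (g g1 g2 : T -> R) (a b c1 c2 : R) :
  measurable_fun setT g -> measurable_fun setT g1 -> measurable_fun setT g2 ->
  (forall t, 0 <= g t) -> (forall t, 0 <= g1 t) -> (forall t, 0 <= g2 t) ->
  0 <= a -> 0 <= b ->
  (forall t, g t <= a * g1 t + b * g2 t) ->
  (\int[mu]_t (g1 t)%:E <= c1%:E)%E -> (\int[mu]_t (g2 t)%:E <= c2%:E)%E ->
  (\int[mu]_t (g t)%:E <= (a * c1 + b * c2)%:E)%E.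
Proof.
move=> mg mg1 mg2 g0 g10 g20 a0 b0 gle h1 h2.
apply: (@le_trans _ _ (\int[mu]_t (a%:E * (g1 t)%:E + b%:E * (g2 t)%:E))%E).
  apply: ge0_le_integral => //.
  - by move=> t _; rewrite lee_fin.
  - exact/measurable_EFinP.
  - by apply: emeasurable_funD; apply: measurable_funeM; exact/measurable_EFinP.
  - by move=> t _; rewrite -!EFinM -EFinD lee_fin.
rewrite ge0_integralD//.
- rewrite !ge0_integralZl_EFin//.
  + by rewrite EFinD !EFinM; apply: leeD; apply: lee_wpmul2l.
  + by move=> t _; rewrite lee_fin.
  + exact/measurable_EFinP.
  + by move=> t _; rewrite lee_fin.
  + exact/measurable_EFinP.
- by move=> t _; rewrite -EFinM lee_fin mulr_ge0.
- by apply: measurable_funeM; exact/measurable_EFinP.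
- by move=> t _; rewrite -EFinM lee_fin mulr_ge0.
- by apply: measurable_funeM; exact/measurable_EFinP.
Qed.
End WeightedL2.
(** * The quadratic forms for L^r, 1 <= r < +oo *)

Section LpQuadratic.
Context {R : realType} {s : scalar_kind} d (T : measurableType d).
Variable mu : {measure set T -> \bar R}.
Local Notation K := (scalar_field R s).
Variables (n : nat) (r : R) (F : 'I_n -> T -> K).
Hypothesis n_gt0 : (0 < n)%N.
Hypothesis r1 : 1 <= r.
Hypothesis mF : forall i, sc_measurable (F i).
Hypothesis F1 : forall i, (\int[mu]_t (sc_abs (F i t) `^ r)%:E <= 1%:E)%E.

Definition pcomb (a : 'rV[R]_n) (t : T) : K :=
  \sum_i sc_of_real (a 0 i) * F i t.

(* W^(1/r) is the density by which the functions are divided: the measure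
   W mu has mass at most n, and in L^r(W mu) the functions F i / W^(1/r) are bounded
   by 1. The integral of dens a is the square of the norm of the combination with
   coefficients a in L^2(W mu). Where W vanishes, all F i do, so dens is 0
   there although h is 1 when r = 2. *)
Let W (t : T) : R := \sum_i sc_abs (F i t) `^ r.
Let h (t : T) : R := W t `^ (1 - 2 / r).
Let dens (a : 'rV[R]_n) (t : T) : R := sc_abs (pcomb a t) ^+ 2 * h t.

Let r_gt0 : 0 < r. Proof. exact: lt_le_trans r1. Qed.
Let n0 : 0 < n%:R :> R. Proof. by rewrite ltr0n. Qed.
Let W_ge0 t : 0 <= W t.
Proof. by apply: sumr_ge0 => i _; exact: powR_ge0. Qed.
Let h_ge0 t : 0 <= h t. Proof. exact: powR_ge0. Qed.
Let dens_ge0 a t : 0 <= dens a t.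
Proof. by rewrite mulr_ge0 ?sqr_ge0. Qed.

Let F_le_W i t : sc_abs (F i t) `^ r <= W t.
Proof.
by rewrite /W (bigD1 i)//= lerDl sumr_ge0// => j _; exact: powR_ge0.
Qed.

Let W0_F i t : W t = 0 -> sc_abs (F i t) = 0.
Proof.
move=> W0; apply: (@powR_eq0_eq0 _ _ r); apply/eqP.
by rewrite eq_le powR_ge0 -W0 F_le_W.
Qed.

Let W0_pcomb a t : W t = 0 -> sc_abs (pcomb a t) = 0.
Proof.
move=> W0; rewrite /pcomb big1 ?sc_abs0// => i _.
by rewrite [F i t](sc_abs_eq0 (W0_F i W0)) mulr0.
Qed.

Let pcomb_linear a b u v t : pcomb (a *: u + b *: v) t =
  sc_of_real a * pcomb u t + sc_of_real b * pcomb v t.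
Proof.
rewrite /pcomb !mulr_sumr -big_split/=; apply: eq_bigr => i _.
by rewrite !mxE sc_of_realD !sc_of_realM; ring.
Qed.

Let pcomb_delta i t : pcomb (delta_mx 0 i) t = F i t.
Proof.
rewrite /pcomb (bigD1 i)//= mxE !eqxx sc_of_real1 mul1r big1 ?addr0// => j ji.
by rewrite mxE (negbTE ji) andbF [sc_of_real _](_ : _ = 0) ?mul0r//; case: (s).
Qed.

Let measurable_pcomb a : sc_measurable (pcomb a).
Proof.
rewrite (_ : pcomb a = \sum_i sc_of_real (a 0 i) *: F i); last first.
  by apply/funext => t; rewrite /pcomb fct_sumE.
elim/big_ind: _ => [|f g|i _]; [exact: sc_measurable0|exact: sc_measurableD|].
exact: sc_measurableZ.
Qed.

Let measurable_abs_powR (f : T -> K) : sc_measurable f ->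
  measurable_fun setT (fun t => sc_abs (f t) `^ r).
Proof.
move=> mf; apply: (measurableT_comp (measurable_powR _)).
exact: measurable_sc_abs.
Qed.

Let mW : measurable_fun setT W.
Proof. by apply: measurable_sum => i; exact: measurable_abs_powR. Qed.

Let mh : measurable_fun setT h.
Proof. exact: (measurableT_comp (measurable_powR _)). Qed.

Let mdens a : measurable_fun setT (dens a).
Proof.
apply: measurable_funM => //; apply: measurable_funX.
exact: measurable_sc_abs.
Qed.

Let int_W : (\int[mu]_t (W t)%:E <= n%:R%:E)%E.
Proof.
under eq_integral do rewrite /W -sumEFin.
rewrite ge0_integral_sum//; last 2 first.
- by move=> i; apply/measurable_EFinP; exact: measurable_abs_powR.
- by move=> i t _; rewrite lee_fin powR_ge0.
apply: (@le_trans _ _ (\sum_(i < n) 1%:E)%E); first by apply: lee_sum => i _.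
by rewrite sumEFin sumr_const card_ord.
Qed.

Let dens_le a t : dens a t <= sum_squares a * \sum_i dens (delta_mx 0 i) t.
Proof.
rewrite /dens -mulr_suml mulrA; apply: ler_wpM2r => //.
apply: (@le_trans _ _ ((\sum_i `|a 0 i| * sc_abs (F i t)) ^+ 2)).
  rewrite ler_sqr ?nnegrE ?sc_abs_ge0//; last first.
    by apply: sumr_ge0 => i _; rewrite mulr_ge0// sc_abs_ge0.
  rewrite /pcomb; elim/big_ind2: _ => [|x y z w xy zw|i _].
  - by rewrite sc_abs0.
  - by apply: le_trans (sc_absD _ _) _; exact: lerD.
  - by rewrite sc_absM sc_abs_of_real.
apply: le_trans (cauchy_schwarz_sum _ _) _.
rewrite /sum_squares; under eq_bigr do rewrite real_normK ?num_real//.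
by under [X in _ <= _ * X]eq_bigr do rewrite pcomb_delta.
Qed.

Let integrable_dens (c : R) a :
  (forall t, \sum_i dens (delta_mx 0 i) t <= c * W t) ->
  mu.-integrable setT (EFin \o dens a).
Proof.
move=> hc; apply/integrableP; split; first exact/measurable_EFinP.
have S0 : 0 <= sum_squares a := (psd_sum_squares n).1 a.
have h1 : (\int[mu]_t (dens a t)%:E <=
    (sum_squares a * `|c| * n%:R + 0 * n%:R)%:E)%E.
  apply: (@integral_le_lin _ _ _ mu _ W W) => //.
    by rewrite mulr_ge0.
  move=> t; rewrite mul0r addr0; apply: le_trans (dens_le _ _) _.
  rewrite -mulrA ler_wpM2l//; apply: le_trans (hc t) _.
  by rewrite ler_wpM2r// ler_norm.
under eq_integral do rewrite /= ger0_norm//.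
exact: le_lt_trans h1 (ltry _).
Qed.

Let Q a : R := (\int[mu]_t dens a t)%R.

Let int_dens (c : R) a :
  (forall t, \sum_i dens (delta_mx 0 i) t <= c * W t) ->
  (\int[mu]_t (dens a t)%:E)%E = (Q a)%:E.
Proof.
move=> hc; rewrite /Q /Rintegral fineK//.
exact: integrable_fin_num (integrable_dens a hc).
Qed.

Let psd_Q (c : R) : (forall t, \sum_i dens (delta_mx 0 i) t <= c * W t) ->
  psd_quadratic Q.
Proof.
by move=> hc; apply: psd_weighted_L2 => // a; exact: (integrable_dens a hc).
Qed.

(* For r <= 2 this exhibits |y|^r as a weighted geometric mean of dens and W. *)
Let dens_powR a t : dens a t `^ (r / 2) * W t `^ (1 - r / 2) =
  sc_abs (pcomb a t) `^ r.
Proof.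
have [W0|W0] := eqVneq (W t) 0.
  rewrite /dens W0_pcomb// expr0n mul0r !powR0 ?mul0r//.
    by rewrite mulf_neq0 ?gt_eqF// invr_gt0.
  by rewrite gt_eqF.
rewrite /dens powRM ?sqr_ge0// -mulrA -powRrM -powRD ?W0 ?implybT//.
rewrite (_ : _ + _ = 0) ?powRr0 ?mulr1; last by field; rewrite gt_eqF.
by rewrite -powR_mulrn ?sc_abs_ge0// -powRrM; congr (_ `^ _); field.
Qed.

Let natr_powRS (t : R) : n%:R `^ (- t) * n%:R = n%:R `^ (1 - t).
Proof.
rewrite -[X in _ * X](powRr1 (ltW n0)) -powRD ?(gt_eqF n0) ?implybT//.
by rewrite addrC.
Qed.

(** Here W^(1-2/r) has a nonpositive exponent and |F i|^r <= W, so dens at e_i is at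
    most |F i|^r. Conversely |y|^r = (|y|^2 h)^(r/2) W^(1-r/2), which AM-GM bounds by
    a combination of dens and W. *)
Lemma Lp_quadratic_le2 : r <= 2 -> exists q, [/\ psd_quadratic q,
  forall i, q (delta_mx 0 i) <= 1 &
  forall a, q a <= 1 ->
    (\int[mu]_t (sc_abs (pcomb a t) `^ r)%:E <= (n%:R `^ (1 - r / 2))%:E)%E].
Proof.
move=> r2.
have dF i t : dens (delta_mx 0 i) t <= sc_abs (F i t) `^ r.
  rewrite /dens pcomb_delta /h.
  have [F0|F0] := eqVneq (sc_abs (F i t)) 0.
    by rewrite F0 expr0n mul0r powR_ge0.
  have Fp : 0 < sc_abs (F i t) by rewrite lt0r F0 sc_abs_ge0.
  have Wp : 0 < W t by apply: lt_le_trans (F_le_W i t); exact: powR_gt0.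
  have e0 : 0 <= 2 / r - 1 by rewrite subr_ge0 ler_pdivlMr// mul1r.
  rewrite -(opprB (2 / r)) powRN ler_pdivrMr ?powR_gt0//.
  apply: (@le_trans _ _ (sc_abs (F i t) `^ r * (sc_abs (F i t) `^ r) `^ (2 / r - 1))).
    rewrite -powRrM -powRD ?F0 ?implybT// -powR_mulrn ?sc_abs_ge0//.
    by rewrite (_ : r + _ = 2%:R)//; field; rewrite gt_eqF.
  rewrite ler_wpM2l ?powR_ge0//; apply: ge0_ler_powR => //.
  - by rewrite nnegrE powR_ge0.
  - by rewrite nnegrE.
have hc t : \sum_i dens (delta_mx 0 i) t <= 1 * W t.
  by rewrite mul1r; apply: ler_sum => i _.
exists Q; split; first exact: psd_Q hc.
  move=> i; rewrite -lee_fin -(int_dens _ hc); apply: le_trans (F1 i).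
  apply: ge0_le_integral => //.
  - by move=> t _; rewrite lee_fin.
  - exact/measurable_EFinP.
  - by apply/measurable_EFinP; exact: measurable_abs_powR.
  - by move=> t _; rewrite lee_fin.
move=> a qa; pose th := r / 2.
have th01 : 0 <= th <= 1.
  rewrite /th; apply/andP; split; first by apply: divr_ge0 => //; exact: ltW.
  by rewrite ler_pdivrMr// mul1r.
have /andP[th0 th1] := th01.
rewrite [X in (_ <= X%:E)%E](_ : _ =
   th * n%:R `^ (1 - th) * 1 + (1 - th) * n%:R `^ (- th) * n%:R); last first.
  by rewrite -/th mulr1 -mulrA natr_powRS; ring.
apply: (@integral_le_lin _ _ _ mu _ (dens a) W) => //.
- exact: measurable_abs_powR.
- by move=> t; exact: powR_ge0.
- by rewrite mulr_ge0 ?powR_ge0.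
- by rewrite mulr_ge0 ?powR_ge0 ?subr_ge0.
- move=> t; rewrite -dens_powR; exact: weighted_AMGM_scaled.
- by rewrite (int_dens _ hc) lee_fin.
Qed.
(** The integral of dens controls L^2(W mu) and the sum of squares controls
    L^oo; since r lies between 2 and oo, the L^r norm is at most a weighted
    geometric mean of the two norms, hence at most the weighted arithmetic mean
    of the two quadratic forms. *)
Lemma Lp_quadratic_ge2 : 2 <= r -> exists q, [/\ psd_quadratic q,
  forall i, q (delta_mx 0 i) <= 1 &
  forall a, q a <= 1 ->
    (\int[mu]_t (sc_abs (pcomb a t) `^ r)%:E <= (n%:R `^ (r / 2 - 1))%:E)%E].
Proof.
move=> r2; pose th := 2 / r.
have th01 : 0 <= th <= 1.
  rewrite /th; apply/andP; split; first by apply: divr_ge0 => //; exact: ltW.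
  by rewrite ler_pdivrMr// mul1r.
have /andP[th0 th1] := th01.
pose D : R := n%:R `^ (1 - th).
have D0 : 0 < D by exact: powR_gt0.
have dF i t : dens (delta_mx 0 i) t <=
    th * D * sc_abs (F i t) `^ r + (1 - th) * n%:R `^ (- th) * W t.
  have := @weighted_AMGM_scaled R th n%:R (sc_abs (F i t) `^ r) (W t) th01 n0
    (powR_ge0 _ _) (W_ge0 t).
  rewrite -powRrM (_ : r * th = 2%:R); last by rewrite /th; field; rewrite gt_eqF.
  by rewrite powR_mulrn ?sc_abs_ge0// /dens pcomb_delta.
have hc t : \sum_i dens (delta_mx 0 i) t <= D * W t.
  apply: le_trans (ler_sum _ (fun i _ => dF i t)) _.
  rewrite big_split/= -mulr_sumr -/(W t) sumr_const card_ord -[X in _ + X <= _]mulr_natr.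
  rewrite [leLHS](_ : _ = th * D * W t + (1 - th) * (n%:R `^ (- th) * n%:R) * W t); last by ring.
  rewrite natr_powRS -/D le_eqVlt; apply/orP; left; apply/eqP; ring.
have QF i : Q (delta_mx 0 i) <= D.
  rewrite -lee_fin -(int_dens _ hc).
  rewrite [X in (_ <= X%:E)%E](_ : _ =
      th * D * 1 + (1 - th) * n%:R `^ (- th) * n%:R); last first.
    by rewrite mulr1 -mulrA natr_powRS -/D; ring.
  apply: (@integral_le_lin _ _ _ mu _ (fun t => sc_abs (F i t) `^ r) W) => //.
  - exact: measurable_abs_powR.
  - by move=> t; exact: powR_ge0.
  - by rewrite mulr_ge0// ltW.
  - by rewrite mulr_ge0 ?powR_ge0 ?subr_ge0.
have Q_ge0 a : 0 <= Q a := (psd_Q hc).1 a.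
have S_ge0 a : 0 <= sum_squares a := (psd_sum_squares n).1 a.
exists (fun a => th / D * Q a + (1 - th) * sum_squares a); split.
- apply: psd_lin; [|by rewrite subr_ge0|exact: psd_Q hc|exact: psd_sum_squares].
  by rewrite divr_ge0// ltW.
- move=> i; rewrite sum_squares_delta mulr1 -mulrA.
  have : D^-1 * Q (delta_mx 0 i) <= 1 by rewrite mulrC ler_pdivrMr// mul1r.
  by move=> /(ler_wpM2l th0); lra.
move=> a qa.
pose S := sum_squares a.
(* This is the bound in L^oo of y / W^(1/r). *)
have yW t : sc_abs (pcomb a t) ^+ 2 <= S * D * W t `^ th.
  have [W0|W0] := eqVneq (W t) 0.
    rewrite W0_pcomb// expr0n/=; apply: mulr_ge0; last exact: powR_ge0.
    by apply: mulr_ge0; [exact: S_ge0|exact: ltW].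
  have Wp : 0 < h t by apply: powR_gt0; rewrite lt0r W0 W_ge0.
  rewrite -(ler_pM2r Wp) -[leLHS]/(dens a t).
  apply: le_trans (dens_le a t) _; rewrite -/S -!mulrA ler_wpM2l//; first exact: S_ge0.
  by rewrite -[h t]/(W t `^ (1 - th)) -powRD ?W0 ?implybT// addrC subrK powRr1//.
have yr t : sc_abs (pcomb a t) `^ r <= (S * D) `^ (r / 2 - 1) * dens a t + 0 * W t.
  rewrite mul0r addr0 /dens mulrCA.
  have [y0|y0] := eqVneq (sc_abs (pcomb a t)) 0.
    by rewrite y0 powR0 ?gt_eqF// expr0n mul0r.
  have W0 : W t != 0 by apply: contraNneq y0 => /W0_pcomb ->.
  rewrite [X in _ `^ X](_ : r = 2%:R * (1 + (r / 2 - 1))); last by field.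
  rewrite powRrM powR_mulrn ?sc_abs_ge0// powRD; last first.
    by rewrite sqrf_eq0 y0 implybT.
  rewrite powRr1 ?sqr_ge0//; apply: ler_wpM2l; first exact: sqr_ge0.
  rewrite /h (_ : 1 - 2 / r = th * (r / 2 - 1)); last first.
    by rewrite /th; field; rewrite gt_eqF.
  rewrite powRrM -powRM ?powR_ge0//; last by rewrite mulr_ge0 ?S_ge0// ltW.
  apply: ge0_ler_powR => //.
  - by rewrite subr_ge0 ler_pdivlMr// mul1r.
  - by rewrite nnegrE sqr_ge0.
  - by rewrite nnegrE (le_trans _ (yW t))// sqr_ge0.
apply: (@le_trans _ _ ((S * D) `^ (r / 2 - 1) * Q a + 0 * n%:R)%:E).
  apply: (@integral_le_lin _ _ _ mu _ (dens a) W) => //.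
  - exact: measurable_abs_powR.
  - by move=> t; exact: powR_ge0.
  - exact: powR_ge0.
  - by rewrite (int_dens _ hc).
rewrite lee_fin mul0r addr0.
have QS : (Q a / D) `^ th * S `^ (1 - th) <= 1.
  apply: le_trans qa; rewrite [th / D * _]mulrAC -[th * Q a / D]mulrA.
  by apply: weighted_AMGM => //; [exact: divr_ge0 (Q_ge0 a) (ltW D0)|exact: S_ge0].
have r20 : 0 <= r / 2 by apply: divr_ge0 => //; exact: ltW.
have := ge0_ler_powR r20 _ _ QS.
rewrite !nnegrE mulr_ge0 ?powR_ge0// ler01 powR1 => /(_ isT isT).
have e1 : th * (r / 2) = 1 by rewrite /th; field; rewrite gt_eqF.
have e2 : (1 - th) * (r / 2) = r / 2 - 1 by rewrite mulrBl e1 mul1r.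
rewrite powRM ?powR_ge0// -!powRrM e1 e2 powRr1; last first.
  by apply: divr_ge0; [exact: Q_ge0|exact: ltW].
move=> QS1.
have DE : n%:R `^ (r / 2 - 1) = D `^ (r / 2) by rewrite /D -powRrM e2.
have DD : D `^ (r / 2) = D `^ (r / 2 - 1) * D.
  rewrite -[X in _ = _ * X](powRr1 (ltW D0)) -powRD ?subrK//.
  by rewrite (gt_eqF D0) implybT.
rewrite DE DD powRM ?S_ge0 ?(ltW D0)//.
move: QS1; rewrite mulrAC ler_pdivrMr// mul1r => QS1.
rewrite mulrAC [leRHS]mulrC; apply: ler_wpM2r; first exact: powR_ge0.
by rewrite mulrC.
Qed.
End LpQuadratic.
(** * The spaces L^p *)

Section LpBound.
Context {R : realType} {s : scalar_kind} d (T : measurableType d).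
Variable mu : {measure set T -> \bar R}.
Local Notation K := (scalar_field R s).

Lemma int_powR_Lnorm (r : R) (f : T -> K) : r != 0 ->
  (\int[mu]_t (sc_abs (f t) `^ r)%:E = sc_Lnorm mu r%:E f `^ r)%E.
Proof.
move=> r0; rewrite /sc_Lnorm powR_Lnorm//; apply: eq_integral => t _ /=.
by rewrite ger0_norm// sc_abs_ge0.
Qed.

Section Fixed.
Variables (p : \bar R) (p1 : (1 <= p)%E).
Local Notation FT := (@Lp_fun d T R s mu p p1).
Local Notation LP := (@Lp d T R s mu p p1).
Local Open Scope quotient_scope.

Lemma rnorm_pi (f : FT) :
  rnorm (\pi_LP f : LP) = fine (sc_Lnorm mu p (Lp_val f)).
Proof.
by apply: (@sc_of_real_inj R s); rewrite rnormK -Lp_pi_norm.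
Qed.

Lemma comb_Lp n (x : 'I_n -> LP) (a : 'rV[R]_n) :
  exists2 f : FT, comb x a = \pi_LP f &
    Lp_val f = pcomb (fun i => Lp_val (repr (x i))) a.
Proof.
exists (\sum_i sc_of_real (a 0 i) *: repr (x i)).
  rewrite /comb; elim/big_rec2: _ => [//|i u f _ ->].
  rewrite -[x i in LHS]reprK.
  rewrite -[(_ *: _ : LP)]/(Lp_scale _ _) Lp_pi_scale.
  by rewrite -[LHS]/(Lp_add _ _) Lp_pi_add.
apply/funext => t; rewrite /pcomb.
by elim/big_rec2: _ => [//|i u f _ <-].
Qed.
End Fixed.

Lemma Lp_euclidean_bound (r : R) (r1 : (1 <= r%:E)%E) n
    (x : 'I_n -> @Lp d T R s mu r%:E r1) : (0 < n)%N ->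
  (forall i, unit_ball (x i)) ->
  euclidean_bound x (n%:R `^ `|2^-1 - r^-1|).
Proof.
move=> n_gt0 x1.
have r1' : 1 <= r by rewrite -lee_fin.
have r0 : 0 < r by exact: lt_le_trans r1'.
pose F i := Lp_val (repr (x i)).
have mF i : sc_measurable (F i).
  by have /[!inE] -[] := Lp_funP (repr (x i)).
have F1 i : (\int[mu]_t (sc_abs (F i t) `^ r)%:E <= 1%:E)%E.
  have /unit_ballE := x1 i; rewrite -[x i]reprK rnorm_pi => h.
  rewrite int_powR_Lnorm ?gt_eqF// -fine_sc_Lnorm poweR_EFin lee_fin.
  rewrite (_ : 1 = 1 `^ r); last by rewrite powR1.
  apply: ge0_ler_powR => //; first exact: ltW.
    by rewrite nnegrE fine_ge0// sc_Lnorm_ge0.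
  by rewrite nnegrE.
have rle (c : R) a : 0 <= c ->
    (\int[mu]_t (sc_abs (pcomb F a t) `^ r)%:E <= (c `^ r)%:E)%E ->
    rnorm (comb x a) <= c.
  move=> c0; have [f -> fE] := comb_Lp x a; rewrite rnorm_pi -fE.
  rewrite int_powR_Lnorm ?gt_eqF// -fine_sc_Lnorm poweR_EFin lee_fin.
  rewrite /= => le_c; rewrite leNgt; apply/negP => /(gt0_ltr_powR r0).
  by rewrite !nnegrE c0 fine_ge0 ?sc_Lnorm_ge0// ltNge le_c => /(_ isT isT).
have [r2|r2] := leP r 2.
  have [q [qP q1 qa]] := Lp_quadratic_le2 n_gt0 r1' mF F1 r2.
  exists q; split=> // a /qa h; apply: rle; first exact: powR_ge0.
  rewrite -powRrM ler0_norm; last first.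
    by rewrite subr_le0 lef_pV2// posrE.
  by rewrite (_ : _ * r = 1 - r / 2)//; field; rewrite gt_eqF.
have [q [qP q1 qa]] := Lp_quadratic_ge2 n_gt0 r1' mF F1 (ltW r2).
exists q; split=> // a /qa h; apply: rle; first exact: powR_ge0.
rewrite -powRrM ger0_norm; last first.
  by rewrite subr_ge0 lef_pV2 ?posrE// ltW.
by rewrite (_ : _ * r = r / 2 - 1)//; field; rewrite gt_eqF.
Qed.

Lemma Lp_euclidean_bound_ext (p : \bar R) (p1 : (1 <= p)%E) n
    (x : 'I_n -> @Lp d T R s mu p p1) : (0 < n)%N ->
  (forall i, unit_ball (x i)) ->
  euclidean_bound x (n%:R `^ `|2^-1 - fine (p^-1)|).
Proof.
case: p p1 x => [r|//|//] p1 x n0 x1; last first.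
  by rewrite /= subr0 ger0_norm//; exact: euclidean_bound_sqrt.
have r0 : r != 0 by rewrite gt_eqF// (lt_le_trans ltr01)// -lee_fin.
rewrite inver (negbTE r0) /=; exact: Lp_euclidean_bound.
Qed.
End LpBound.

Theorem proposition3 (R : realType) (s : scalar_kind)
    (n m : nat) (k : 'I_n -> nat)
    (sum_k : (\sum_(i < n) k i = m)%N) (m_gt0 : (0 < m)%N) :
  [/\ forall (d : measure_display) (T : measurableType d)
        (mu : {measure set T -> \bar R}) (p : \bar R) (p1 : (1 <= p)%E),
        (polarization_const (Lp s mu p1) k <=
          (n%:R `^ (m%:R * `| 2^-1 - fine (p^-1) |)%R)%R%:E)%E,
      forall X : completeNormedModType (scalar_field R s),
        (polarization_const X k <= (n%:R `^ (m%:R / 2))%R%:E)%E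
    & (forall i, k i = 1%N) ->
      [/\ n = m,
          forall (d : measure_display) (T : measurableType d)
            (mu : {measure set T -> \bar R}) (p : \bar R) (p1 : (1 <= p)%E),
            (polarization_const_full (Lp s mu p1) m <=
              (m%:R `^ (m%:R * `| 2^-1 - fine (p^-1) |)%R)%R%:E)%E
        & forall X : completeNormedModType (scalar_field R s),
            (polarization_const_full X m <= (m%:R `^ (m%:R / 2))%R%:E)%E]].
Proof.
have n_gt0 : (0 < n)%N.
  by case: n k sum_k => // k; rewrite big_ord0 => m0; rewrite -m0 in m_gt0.
have powRE (l : nat) (c : R) : l%:R `^ (m%:R * c) = (l%:R `^ c) ^+ m.
  by rewrite mulrC powRrM powR_mulrn// powR_ge0.
have p_gt0 (l : nat) (c : R) : (0 < l)%N -> 0 < l%:R `^ c :> R.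
  by move=> l0; rewrite powR_gt0// ltr0n.
split=> [d T mu p p1|X|k1].
- rewrite powRE -sum_k; apply: polarization_const_le; first exact: p_gt0.
  by move=> x; exact: Lp_euclidean_bound_ext.
- rewrite powRE -sum_k; apply: polarization_const_le; first exact: p_gt0.
  by move=> x; exact: euclidean_bound_sqrt.
split=> [|d T mu p p1|X].
- by rewrite -sum_k (eq_bigr (fun=> 1%N))// sum1_card card_ord.
- rewrite powRE; apply: polarization_const_full_le; first exact: p_gt0.
  by move=> x; exact: Lp_euclidean_bound_ext.
- rewrite powRE; apply: polarization_const_full_le; first exact: p_gt0.
  by move=> x; exact: euclidean_bound_sqrt.
Qed.
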